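(* Let $n\ge 2$. For every $J\subseteq[n-2]$, the vertically rotated inverse descent class $C_nD_{n-1,J}^{-1}\subseteq\mathfrak{S}_n$ is cyclic Schur-positive.
   Context: Permutations are written in one-line notation and composed right to left. For $\pi\in\mathfrak{S}_n$, $\mathrm{Des}(\pi)=\{i\in[n-1]:\pi(i)>\pi(i+1)\}$ and $\mathrm{cDes}(\pi)=\{i\in[n]:\pi(i)>\pi(i+1)\}$ with $\pi(n+1):=\pi(1)$. For $J\subseteq[n]$, $\mathbf{x}^J=\prod_{i\in J}x_i$, and $i+J=\{i+j\bmod n:j\in J\}\subseteq[n]$. Let $c_n=(1,2,\dots,n)=23\cdots n1$, $C_n=\langle c_n\rangle$. $D_{n-1,J}=\{\pi\in\mathfrak{S}_{n-1}:\mathrm{Des}(\pi)=J\}$ and $D_{n-1,J}^{-1}$ is the set of inverses, viewed inside $\mathfrak{S}_n$ as permutations fixing $n$; $C_nA=\{c\sigma:c\in C_n,\sigma\in A\}$. Cyclic Schur-positivity: for a skew shape $\lambda/\mu$ with $n$ cells, the descent set of $T\in\mathrm{SYT}(\lambda/\mu)$ is the set of $i\in[n-1]$ with $i+1$ in a strictly lower row than $i$. A cyclic descent extension on $\mathrm{SYT}(\lambda/\mu)$ is a pair $(\mathrm{cDes},\psi)$, $\mathrm{cDes}:\mathrm{SYT}(\lambda/\mu)\to2^{[n]}$, $\psi$ a bijection, with $\mathrm{cDes}(T)\cap[n-1]=\mathrm{Des}(T)$, $\mathrm{cDes}(\psi T)=1+\mathrm{cDes}(T)$, $\emptyset\ne\mathrm{cDes}(T)\ne[n]$.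 It exists iff $\lambda/\mu$ is not a connected ribbon, and then $\sum_{T}\mathbf{x}^{\mathrm{cDes}(T)}$ is independent of the choice. $A\subseteq\mathfrak{S}_n$ is cyclic Schur-positive if there are nonnegative integers $m_{\lambda/\mu}$ (over skew shapes with $n$ cells that are not connected ribbons) with $\sum_{\pi\in A}\mathbf{x}^{\mathrm{cDes}(\pi)}=\sum m_{\lambda/\mu}\sum_{T\in\mathrm{SYT}(\lambda/\mu)}\mathbf{x}^{\mathrm{cDes}(T)}$. *)

(* Defs.v *)
From HB Require Import structures.
From mathcomp Require Import all_boot all_order all_algebra all_fingroup.
From mathcomp Require Import mpoly.

Set Implicit Arguments.
Unset Strict Implicit.
Unset Printing Implicit Defensive.

Import GRing.Theory.
Local Open Scope ring_scope.

(* Conventions: [n] = {1,...,n} is represented by 'I_n, element i : 'I_n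
   standing for the number i+1.  Subsets of [n] are {set 'I_n}.  A
   permutation of [n] is a {perm 'I_n}; pi(i) in the paper is pi i here
   (shifted by one in both argument and value, which preserves order). *)

Definition xmon (n : nat) (J : {set 'I_n}) : {mpoly int[n]} :=
  \prod_(i in J) 'X_i.

Definition shift1 (n : nat) (J : {set 'I_n}) : {set 'I_n} :=
  [set j : 'I_n | [exists i in J, nat_of_ord j == ((nat_of_ord i).+1 %% n)%N]].

Definition perm_cDes (n : nat) (p : {perm 'I_n}) : {set 'I_n} :=
  [set i : 'I_n | [exists j : 'I_n,
     (nat_of_ord j == ((nat_of_ord i).+1 %% n)%N) && (p j < p i)%N]].

(* D_{n-1,J}^{-1}, viewed inside S_n: the permutations s of [n] with
   s(n) = n such that the restriction tau of s^{-1} to [n-1] has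
   Des(tau) = J, where Des(tau) = {i in [n-2] : tau(i) > tau(i+1)}. *)
Definition invDesClass (n : nat) (J : {set 'I_n}) : {set {perm 'I_n}} :=
  [set s : {perm 'I_n} |
     [forall i : 'I_n, (nat_of_ord i == n.-1) ==> (s i == i)] &&
     ([set i : 'I_n | ((nat_of_ord i).+2 < n)%N &&
        [exists j : 'I_n, (nat_of_ord j == (nat_of_ord i).+1) &&
                          ((s^-1)%g j < (s^-1)%g i)%N]] == J)].

(* C_n A = {c sigma : c in C_n, sigma in A}, where C_n = <c_n>,
   c_n = (1,2,...,n) maps i to i+1 mod n; so c_n^k sigma maps i to
   sigma(i) + k mod n (composition right to left). *)
Definition rotClass (n : nat) (A : {set {perm 'I_n}}) : {set {perm 'I_n}} :=
  [set p : {perm 'I_n} | [exists k : 'I_n, exists s in A,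
     [forall i : 'I_n, nat_of_ord (p i) == ((nat_of_ord (s i) + k) %% n)%N]]].

Definition is_partition (l : seq nat) : bool :=
  sorted geq l && all (fun x => 0 < x)%N l.

Definition skew_shape (n : nat) (lam mu : seq nat) : bool :=
  [&& is_partition lam, is_partition mu, (size mu <= size lam)%N,
      all (fun i => nth 0 mu i <= nth 0 lam i)%N (iota 0 (size mu)) &
      sumn lam == (sumn mu + n)%N].

(* the cell in row r, column c (0-based, English notation) of lam/mu *)
Definition in_skew (lam mu : seq nat) (r c : nat) : bool :=
  (nth 0 mu r <= c < nth 0 lam r)%N.

(* a finite type containing all cells of lam/mu *)
Definition cellT (lam : seq nat) := ('I_(size lam) * 'I_(head 0%N lam))%type.

Definition cell_in (lam mu : seq nat) (x : cellT lam) : bool :=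
  in_skew lam mu x.1 x.2.

Definition skew_adj (lam mu : seq nat) : rel (cellT lam) :=
  fun x y => [&& cell_in mu x, cell_in mu y &
     ((nat_of_ord x.1 == nat_of_ord y.1) &&
        (((nat_of_ord x.2).+1 == nat_of_ord y.2) ||
         ((nat_of_ord y.2).+1 == nat_of_ord x.2)))
  || ((nat_of_ord x.2 == nat_of_ord y.2) &&
        (((nat_of_ord x.1).+1 == nat_of_ord y.1) ||
         ((nat_of_ord y.1).+1 == nat_of_ord x.1)))].

Definition skew_connected (lam mu : seq nat) : bool :=
  [forall x : cellT lam, forall y : cellT lam,
     cell_in mu x ==> cell_in mu y ==> connect (skew_adj mu) x y].

Definition no_square (lam mu : seq nat) : bool :=
  ~~ [exists x : cellT lam,
       [&& in_skew lam mu x.1 x.2, in_skew lam mu x.1.+1 x.2,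
           in_skew lam mu x.1 x.2.+1 & in_skew lam mu x.1.+1 x.2.+1]].

Definition connected_ribbon (lam mu : seq nat) : bool :=
  skew_connected lam mu && no_square lam mu.

(* a filling: T k is the cell containing the entry k+1 *)
Definition tab (n : nat) (lam : seq nat) := {ffun 'I_n -> cellT lam}.

Definition is_SYT (n : nat) (lam mu : seq nat) (T : tab n lam) : bool :=
  [&& injectiveb T,
      [forall k, cell_in mu (T k)],
      [forall a, forall b,
         ((nat_of_ord (T a).1 == nat_of_ord (T b).1) &&
          (nat_of_ord (T a).2 < nat_of_ord (T b).2)%N) ==> (a < b)%N] &
      [forall a, forall b,
         ((nat_of_ord (T a).2 == nat_of_ord (T b).2) &&
          (nat_of_ord (T a).1 < nat_of_ord (T b).1)%N) ==> (a < b)%N]].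

Definition SYT (n : nat) (lam mu : seq nat) : {set tab n lam} :=
  [set T | is_SYT mu T].
Arguments SYT : clear implicits.

Definition tab_Des (n : nat) (lam : seq nat) (T : tab n lam) : {set 'I_n} :=
  [set i : 'I_n | [exists j : 'I_n, (nat_of_ord j == (nat_of_ord i).+1) &&
                     (nat_of_ord (T i).1 < nat_of_ord (T j).1)%N]].

Definition cyclic_descent_ext (n : nat) (lam mu : seq nat)
    (cD : tab n lam -> {set 'I_n}) : Prop :=
  exists psi : tab n lam -> tab n lam,
    {in SYT n lam mu, forall T, psi T \in SYT n lam mu} /\
    {in SYT n lam mu &, injective psi} /\
    {in SYT n lam mu, forall T,
       [set i in cD T | ((nat_of_ord i).+1 < n)%N] = tab_Des T /\
       cD (psi T) = shift1 (cD T) /\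
       cD T != set0 /\ cD T != setT}.
Arguments cyclic_descent_ext : clear implicits.

(* A is cyclic Schur-positive: there are skew shapes (non connected
   ribbons, with n cells) with multiplicities m, listed in s as triples
   (lam, mu, m), and (a choice of) cyclic descent extensions cD on them,
   such that sum_{pi in A} x^{cDes pi} = sum m * sum_T x^{cDes T}. *)
Definition cyclic_Schur_positive (n : nat) (A : {set {perm 'I_n}}) : Prop :=
  exists (s : seq (seq nat * seq nat * nat))
         (cD : forall lam mu : seq nat, tab n lam -> {set 'I_n}),
    (forall x, x \in s ->
       [/\ skew_shape n x.1.1 x.1.2, ~~ connected_ribbon x.1.1 x.1.2 &
           cyclic_descent_ext n x.1.1 x.1.2 (cD x.1.1 x.1.2)]) /\
    \sum_(p in A) xmon (perm_cDes p) =
    \sum_(x <- s) (x.2)%:R *: \sum_(T in SYT n x.1.1 x.1.2) xmon (cD x.1.1 x.1.2 T).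

(* Main.v *)
Require Import Defs.
From mathcomp Require Import all_boot all_order all_algebra all_fingroup.
From mathcomp Require Import mpoly zify.

(** The sum over C_n D_{n-1,J}^{-1} is that of a single shape: the ribbon with
    descent set J plus a detached box. Reading this shape row by row identifies
    its tableaux, descent sets included, with the permutations p for which
    Des(p^{-1}), restricted to [n-2], is J. So it suffices to show that
    (a) Des has the same distribution on this set and on C_n D_{n-1,J}^{-1}, and
    (b) the distribution of cDes on C_n D_{n-1,J}^{-1} is invariant under
    rotation; then cDes can be carried over to the tableaux along any
    Des-preserving bijection.

    By inclusion-exclusion, descent sets may be replaced by upper bounds for
    them, J for inverse descents and S <> 0 for cyclic descents. The elements of
    J cut the values into rows, with the value n alone in the last row, and those
    of S cut the cycle of positions into arcs. Both (a) and (b) follow once the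
    permutations in question are counted by the classes of assignments of rows
    to positions, up to permutations of the positions inside each arc: this
    number depends on S only up to rotation. For (a), on the side of the shape,
    take the row of p(i): each class contains exactly one function that
    increases along every arc. For p = c^k s with s(n) = n, let y be the position
    of the smallest value of p; then the row function of s, with the entries at
    y and n exchanged, is a representative, and every class is hit exactly once.
    Indeed y starts an arc, the arc being that of the unique entry in the last
    row; the row of s(y) is the entry of a prescribed rank in the arc of n; and
    the remaining entries are forced by monotonicity of p on arcs. *)

Set Implicit Arguments.
Unset Strict Implicit.
Unset Printing Implicit Defensive.

(** * Sorting and standardization *)

Section Orders.
Variable n : nat.
Implicit Types (s t r : {perm 'I_n}) (i j u v w : 'I_n) (D : {set 'I_n}).

Lemma card_ord_lt k : k <= n -> #|[set v : 'I_n | v < k]| = k.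
Proof.
move=> le_kn; rewrite cardsE -sum1_card.
rewrite (eq_bigl (fun v : 'I_n => v < k)); last by [].
by rewrite (big_ord_narrow le_kn) sum1_card card_ord.
Qed.

Lemma perm_rank s i : #|[set j | s j < s i]| = s i.
Proof.
have := card_preimset [set v : 'I_n | v < s i] (@perm_inj _ s).
rewrite card_ord_lt => [eqc|]; last exact: ltnW.
by rewrite -[RHS]eqc; apply: eq_card => j; rewrite !inE.
Qed.

Lemma perm_lt_inj s t : (forall i j, (s i < s j) = (t i < t j)) -> s = t.
Proof.
move=> lt_st; apply/permP => i; apply/val_inj; rewrite /= -(perm_rank s) -(perm_rank t).
by apply: eq_card => j; rewrite !inE lt_st.
Qed.

Lemma perm_of_order (lt : rel 'I_n) :
  irreflexive lt -> transitive lt ->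
  (forall i j, i != j -> lt i j || lt j i) ->
  exists s, forall i j, (s i < s j) = lt i j.
Proof.
move=> irr tr tot.
have bnd i : #|[set j | lt j i]| < n.
  rewrite -[X in _ < X]card_ord -cardsT; apply: proper_card.
  by apply/properP; split; [exact: subsetT | exists i; rewrite ?inE ?irr].
have mono i j : lt i j -> #|[set k | lt k i]| < #|[set k | lt k j]|.
  move=> ltij; apply: proper_card; apply/properP; split.
    by apply/subsetP => k; rewrite !inE => /tr; apply.
  by exists i; rewrite inE ?irr.
pose f i := Ordinal (bnd i).
have ltf i j : (f i < f j) = lt i j.
  apply/idP/idP => [|/mono //]; case: (eqVneq i j) => [->|/tot]; first by rewrite ltnn.
  case/orP => // /mono /= ltji ltij; lia.
have injf : injective f.
  move=> i j eqf; apply/eqP; apply: contraT => /tot.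
  by rewrite -!ltf eqf ltnn.
by exists (perm injf) => i j; rewrite !permE ltf.
Qed.

Definition lex (A : 'I_n -> nat) (lt : rel 'I_n) : rel 'I_n :=
  fun i j => (A i < A j) || (A i == A j) && lt i j.

Lemma lex_irr A lt : irreflexive lt -> irreflexive (lex A lt).
Proof. by move=> irr i; rewrite /lex ltnn irr andbF. Qed.

Lemma lex_trans A lt : transitive lt -> transitive (lex A lt).
Proof.
move=> tr j i k; rewrite /lex => /orP[ij|/andP[/eqP-> ij]].
  by case/orP => [/(ltn_trans ij)->|/andP[/eqP<- _]]; rewrite ?ij.
by case/orP => [->|/andP[-> /(tr _ _ _ ij)->]]; rewrite ?orbT.
Qed.

Lemma lex_total A (lt : rel 'I_n) :
  (forall i j, i != j -> lt i j || lt j i) ->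
  forall i j, i != j -> lex A lt i j || lex A lt j i.
Proof. by move=> tot i j /tot; rewrite /lex; case: ltngtP. Qed.

(** On the class [A i = x], [f] and [f \o r] are weakly increasing arrangements of the same
    multiset. At a place where one is smaller, the other has strictly fewer entries up to that
    smaller value. *)
Lemma sorted_perm_eq (A f : 'I_n -> nat) r x :
  (forall i, A (r i) = A i) ->
  (forall i j, A i = x -> A j = x -> i < j -> f i <= f j) ->
  (forall i j, A i = x -> A j = x -> i < j -> f (r i) <= f (r j)) ->
  forall i, A i = x -> f (r i) = f i.
Proof.
move=> Ar sf sfr i Ai.
have eqc (v : nat) : #|[set k | (A k == x) && (f (r k) <= v)]| =
             #|[set k | (A k == x) && (f k <= v)]|.
  rewrite -(card_preimset [set k | (A k == x) && (f k <= v)] (@perm_inj _ r)).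
  by apply: eq_card => k; rewrite !inE Ar.
have key (g h : 'I_n -> nat) :
  (forall i j, A i = x -> A j = x -> i < j -> g i <= g j) ->
  (forall i j, A i = x -> A j = x -> i < j -> h i <= h j) ->
  g i < h i -> #|[set k | (A k == x) && (h k <= g i)]| <
               #|[set k | (A k == x) && (g k <= g i)]|.
  move=> sg sh lt; apply: proper_card; apply/properP; split.
    apply/subsetP => k; rewrite !inE => /andP[/eqP Ak hk]; rewrite Ak eqxx /=.
    case: (ltngtP k i) => [/sg -> //|ik|/val_inj-> //].
    by have := sh _ _ Ai Ak ik; lia.
  by exists i; rewrite !inE Ai eqxx ?leqnn //= -ltnNge.
case: (ltngtP (f (r i)) (f i)) => // lt.
  by have := leq_trans (key (f \o r) f sfr sf lt) (eq_leq (eqc _)); rewrite ltnn.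
by have := leq_ltn_trans (eq_leq (esym (eqc _))) (key f (f \o r) sf sfr lt); rewrite ltnn.
Qed.

(** [P] ranks positions by ([A], [O]) and [Q] by ([A], [V], [O]); matching equal ranks gives [r]. It
    preserves [A] since both rankings list the values of [A] in weakly increasing order. *)
Lemma sort_perm (A O V : 'I_n -> nat) :
  injective O ->
  exists r, (forall i, A (r i) = A i) /\
    (forall i j, A i = A j -> O i < O j -> V (r i) <= V (r j)).
Proof.
move=> injO.
pose ltO : rel 'I_n := fun i j => O i < O j.
have irr : irreflexive ltO by move=> i; rewrite /ltO ltnn.
have tr : transitive ltO by move=> j i k; apply: ltn_trans.
have tot i j : i != j -> ltO i j || ltO j i.
  by rewrite /ltO; case: ltngtP => // /injO->; rewrite eqxx.
have [P ltP] := perm_of_order (lex_irr A irr) (@lex_trans A _ tr)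
  (lex_total A tot).
have [Q ltQ] := perm_of_order (lex_irr A (lex_irr V irr))
  (@lex_trans A _ (@lex_trans V _ tr))
  (lex_total A (lex_total V tot)).
pose r := (P * Q^-1)%g.
have Qr i : Q (r i) = P i by rewrite permM permKV.
have Ar i : A (r i) = A i.
  have sP u v : u < v -> A (P^-1%g u) <= A (P^-1%g v).
    by move=> uv; have := ltP (P^-1%g u) (P^-1%g v); rewrite !permKV uv /lex; lia.
  have sQ u v : u < v -> A (Q^-1%g u) <= A (Q^-1%g v).
    by move=> uv; have := ltQ (Q^-1%g u) (Q^-1%g v); rewrite !permKV uv /lex; lia.
  have := @sorted_perm_eq (fun=> 0) (A \o P^-1%g) (Q^-1 * P)%g 0 (fun=> erefl)
    (fun i j _ _ => sP i j).
  rewrite /= => /(_ _ (P i)).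
  rewrite !permM !permK => -> // u v _ _.
  by rewrite !permM !permK; apply: sQ.
exists r; split => // i j Aij Oij.
have: Q (r i) < Q (r j) by rewrite !Qr ltP /lex Aij eqxx /ltO Oij orbT.
by rewrite ltQ /lex !Ar Aij; lia.
Qed.

(** An element [d] of [D] is read as a cut between [d] and [d.+1], so this numbers the block
    containing [k]. Rows of values and arcs of positions are both coded this way. *)
Definition cnt D (k : nat) := #|[set d in D | d < k]|.

Lemma cnt0 D : cnt D 0 = 0.
Proof. by apply/eqP; rewrite cards_eq0; apply/eqP/setP => d; rewrite !inE andbF. Qed.

Lemma cntS D w : cnt D w.+1 = cnt D w + (w \in D).
Proof.
rewrite /cnt (cardsD1 w [set d in D | d < w.+1]) !inE ltnS leqnn andbT addnC; congr (_ + _).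
apply: eq_card => d; rewrite !inE -val_eqE /=; case: (d \in D); lia.
Qed.

Lemma cnt_le D k l : k <= l -> cnt D k <= cnt D l.
Proof.
move=> kl; apply/subset_leq_card/subsetP => d; rewrite !inE => /andP[-> /=].
by move/leq_trans; apply.
Qed.

Lemma cnt_all D k : n <= k -> cnt D k = #|D|.
Proof.
move=> nk; apply: eq_card => d; rewrite inE; case: (d \in D) => //=.
exact: leq_trans (ltn_ord d) nk.
Qed.

Lemma cnt_max D k : cnt D k <= #|D|.
Proof. by apply/subset_leq_card/subsetP => d; rewrite inE => /andP[]. Qed.

Lemma cnt_eqN D (k l : nat) w : k <= w < l -> cnt D k = cnt D l -> w \notin D.
Proof.
case/andP => kw wl eqc; apply/negP => wD.
have := cnt_le D kw; have := cnt_le D wl; rewrite cntS wD; lia.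
Qed.

(** No cut separates two elements of one block, so the comparisons of neighbours chain together. *)
Lemma cnt_chain (g : 'I_n -> nat) D :
  (forall w w', w' = w.+1 :> nat -> w \notin D -> g w < g w') ->
  forall u v, u < v -> cnt D u = cnt D v -> g u < g v.
Proof.
move=> gD u v; move: {2}(v - u) (leqnn (v - u)) => k.
elim: k v => [|k IH] v lek uv eqc; first lia.
have lt : v.-1 < n by have := ltn_ord v; lia.
pose w := Ordinal lt.
have vw : v = w.+1 :> nat by rewrite /=; lia.
have wD : w \notin D by apply: cnt_eqN eqc; rewrite /=; lia.
have := gD w v vw wD; case: (ltngtP u w) => [uw|wu|/val_inj->] //; last by move=> _; rewrite /= in wu; lia.
apply: ltn_trans; apply: IH => //; first by rewrite /=; rewrite /= in uw; lia.
rewrite eqc; have := cntS D w; rewrite (negbTE wD) addn0 /= => <-.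
by congr (cnt D _); lia.
Qed.

End Orders.

(** * Arcs of the cycle and rotation to a fixed maximum *)

(** [X] and [Y] both represent every class of [R] exactly once; sending an element to a
    representative of its class on the other side is injective. *)
Lemma card_transversal (T U W : finType) (R : rel W) (X : {set T}) (Y : {set U})
    (f : T -> W) (g : U -> W) :
  ssrbool.symmetric R -> transitive R ->
  {in X &, forall a b, R (f a) (f b) -> a = b} ->
  (forall w, exists2 a, a \in X & R (f a) w) ->
  {in Y &, forall a b, R (g a) (g b) -> a = b} ->
  (forall w, exists2 a, a \in Y & R (g a) w) ->
  #|X| = #|Y|.
Proof.
move=> symR trR.
have half (T1 U1 : finType) (X1 : {set T1}) (Y1 : {set U1}) f1 g1 :
    {in X1 &, forall a b, R (f1 a) (f1 b) -> a = b} ->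
    (forall w, exists2 a, a \in Y1 & R (g1 a) w) -> #|X1| <= #|Y1|.
  move=> injX surY; pose F a := [pick b in Y1 | R (g1 b) (f1 a)].
  have FP a : exists b, [/\ F a = Some b, b \in Y1 & R (g1 b) (f1 a)].
    rewrite /F; case: pickP => [b /andP[]|none]; first by exists b.
    by have [b bY Rb] := surY (f1 a); have := none b; rewrite /= bY Rb.
  have injF : {in X1 &, injective F}.
    move=> a a' aX aX'; have [b [-> _ Rb]] := FP a; have [b' [-> _ Rb']] := FP a'.
    by case=> eqb; apply: injX => //; apply: trR Rb'; rewrite symR -eqb.
  rewrite -(card_in_imset injF) -(card_imset Y1 (@Some_inj _)).
  apply/subset_leq_card/subsetP => _ /imsetP[a _ ->].
  by have [b [-> bY _]] := FP a; apply: imset_f.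
by move=> iX sX iY sY; apply/eqP; rewrite eqn_leq (half _ _ _ _ f g) // (half _ _ _ _ g f).
Qed.

Section Core.
Variable m : nat.
Local Notation n := m.+2.
Local Notation L := (@ord_max m.+1).
Implicit Types (p s g : {perm 'I_n}) (i j u v w y : 'I_n) (S D : {set 'I_n}).

Lemma ordS_lt w w' : w' = w.+1 :> nat -> ordS w = w'.
Proof. by move=> e; apply/val_inj; rewrite /= -e modn_small. Qed.

Lemma ordS_max : ordS L = ord0.
Proof. by apply/val_inj; rewrite /= modnn. Qed.

Lemma in_cDes p i : (i \in perm_cDes p) = (p (ordS i) < p i).
Proof.
rewrite inE; apply/existsP/idP => [[j /andP[/eqP ej]]|lt]; last by exists (ordS i); rewrite /= eqxx.
by have -> : j = ordS i by apply/val_inj.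
Qed.

Lemma perm_ordS_neq p i : (p i < p (ordS i)) = ~~ (p (ordS i) < p i).
Proof.
case: ltngtP => // /val_inj/perm_inj/(congr1 val) /=.
have := ltn_ord i; case: (ltngtP i.+1 n) => [lt|lt|e] _; [rewrite modn_small //|..|rewrite e modnn]; lia.
Qed.

Lemma cDes_subP p S :
  reflect (forall i, i \notin S -> p i < p (ordS i)) (perm_cDes p \subset S).
Proof.
apply: (iffP subsetP) => H i.
  by rewrite perm_ordS_neq -in_cDes; apply/contra/H.
by rewrite in_cDes; apply: contraTT => /H; rewrite perm_ordS_neq.
Qed.

Lemma val_subZp (a b : 'I_n) :
  (a - b)%R = (if a < b then a + n - b else a - b) :> nat.
Proof.
rewrite /= modnDmr; have := ltn_ord a; have := ltn_ord b.
case: (ltnP a b) => ab bn an; first by rewrite modn_small; lia.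
by rewrite (_ : a + (n - b) = a - b + n) ?modnDr ?modn_small; lia.
Qed.

Definition rotp (k : 'I_n) : {perm 'I_n} := perm (GRing.addIr k).

(* The representative of the coset [C_n p] that fixes the last position. *)
Definition normp p := locked (p * rotp (L - p L)%R)%g.

Lemma normpE p i : normp p i = (p i + (L - p L))%R.
Proof. by rewrite /normp -lock permM permE. Qed.

Lemma normp_max p : normp p L = L.
Proof. by rewrite normpE GRing.addrCA GRing.subrr GRing.addr0. Qed.

Lemma normpK p y k : p y = ord0 -> p k = (normp p k - normp p y)%R.
Proof.
by move=> py; rewrite !normpE py GRing.opprD GRing.addrACA GRing.subrr GRing.addr0 GRing.subr0.
Qed.

(** [p] is [normp p] with its values rotated so that the one at [y] becomes 0: the values from
    [normp p y] upwards come first, then the smaller ones. *)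
Lemma normp_lt p y i j : p y = ord0 ->
  (p i < p j) = ((normp p i < normp p y) < (normp p j < normp p y)) ||
    ((normp p i < normp p y) == (normp p j < normp p y)) && (normp p i < normp p j).
Proof.
move=> py.
have := val_subZp (normp p i) (normp p y); have := val_subZp (normp p j) (normp p y).
rewrite -!(normpK _ py) => -> ->; have := ltn_ord (normp p i); have := ltn_ord (normp p j).
have := ltn_ord (normp p y).
case: (ltnP (normp p i) (normp p y)) => ?; case: (ltnP (normp p j) (normp p y)) => ? /=; lia.
Qed.

Section Arcs.
Variable S : {set 'I_n}.

(* Counts [0] and [#|S|] are identified: these positions form one cyclic arc. *)
Definition arc i := cnt S i %% #|S|.

Lemma arc_eq i j : arc i = arc j ->
  [\/ cnt S i = cnt S j, cnt S i = 0 /\ cnt S j = #|S| | cnt S i = #|S| /\ cnt S j = 0].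
Proof.
rewrite /arc; have := cnt_max S i; have := cnt_max S j.
rewrite (leq_eqVlt (cnt S i)) (leq_eqVlt (cnt S j)).
case/predU1P => [->|lj]; case/predU1P => [->|li]; rewrite ?modnn ?(modn_small li) ?(modn_small lj) => e.
- exact: Or31.
- exact: Or32.
- exact: Or33.
- exact: Or31.
Qed.

Lemma cnt_ordmax : cnt S L + (L \in S) = #|S|.
Proof. by rewrite -cntS cnt_all. Qed.

Lemma cnt_le_max i : cnt S i <= cnt S L.
Proof. by apply: cnt_le; rewrite -ltnS. Qed.

Lemma arc_ordS i : i \notin S -> arc (ordS i) = arc i.
Proof.
move=> iS; rewrite /arc; case: (eqVneq i L) => [iL|iL].
  by have := cnt_ordmax; rewrite -iL (negbTE iS) addn0 => ->; rewrite iL ordS_max cnt0 mod0n modnn.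
have lt : i.+1 < n by move: iL; rewrite -val_eqE /=; have := ltn_ord i; lia.
by rewrite (@ordS_lt i (Ordinal lt)) //= cntS (negbTE iS) addn0.
Qed.

(** The condition [ord_pred y \in S] says that [y] starts an arc. The cut at [y - 1] is counted at
    [y] but not at [i]. *)
Lemma start_cnt y : ord_pred y \in S -> forall i, i < y -> cnt S i < cnt S y.
Proof.
move=> yS i iy.
have e : ord_pred y = y.-1 :> nat.
  by rewrite /= (_ : (y + n).-1 = y.-1 + n) ?modnDr ?modn_small; have := ltn_ord y; lia.
have := cntS S (ord_pred y); rewrite yS e (_ : y.-1.+1 = y); last lia.
have := @cnt_le _ S i y.-1; lia.
Qed.

Lemma start_cnt_gt0 y : ord_pred y \in S -> L \notin S -> 0 < cnt S y.
Proof.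
move=> yS LS; case: (posnP y) => [y0|y0]; last by have := @start_cnt _ yS ord0 y0; lia.
case/negP: LS; rewrite (_ : L = ord_pred y) //.
by apply/val_inj; rewrite /= y0 modn_small.
Qed.

Lemma max_notin i : cnt S i = #|S| -> L \notin S.
Proof. by have := cnt_le_max i; have := cnt_ordmax; case: (L \in S) => //; lia. Qed.

(** With equal counts, the cut before the later start would raise the count. In the wrapped cases
    [L] is not a cut, so a start has positive count and cannot be at level 0. *)
Lemma start_inj y y' :
  ord_pred y \in S -> ord_pred y' \in S -> arc y = arc y' -> y = y'.
Proof.
move=> yS yS' /arc_eq[e|[e e']|[e e']].
- apply/val_inj; case: (ltngtP y y') => // lt.
    by have := start_cnt yS' lt; rewrite e ltnn.
  by have := start_cnt yS lt; rewrite e ltnn.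
- by have := start_cnt_gt0 yS (max_notin e'); rewrite e.
- by have := start_cnt_gt0 yS' (max_notin e); rewrite e'.
Qed.

Lemma arc_start i : 0 < #|S| -> exists2 y, ord_pred y \in S & arc y = arc i.
Proof.
rewrite card_gt0 => /set0Pn[s sS].
(* Walk from some cut to [i] by successors; the start sought follows the last cut passed. *)
have [k] : exists k, i = iter k.+1 (@ordS n) s.
  exists (i + n - s).-1; apply/val_inj.
  have itE k : iter k (@ordS n) s = (s + k) %% n :> nat.
    elim: k => [|k IH]; first by rewrite addn0 modn_small.
    by rewrite iterS [LHS]/= IH -addn1 modnDml addn1 addnS.
  rewrite [RHS]itE (_ : s + _ = i + n) ?modnDr ?modn_small //.
  have := ltn_ord s; lia.
elim: k i => [|k IH] i; first by move=> ->; exists (iter 1 (@ordS n) s); rewrite //= ordSK.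
rewrite iterS; set i' := iter _ _ _ => ->.
case: (boolP (i' \in S)) => iS; first by exists (ordS i'); rewrite ?ordSK.
by have [y yS ey] := IH i' erefl; exists y; rewrite // arc_ordS.
Qed.

Section Chain.
Variable p : {perm 'I_n}.
Hypothesis pS : forall i, i \notin S -> p i < p (ordS i).

Lemma chain_lt i j : i < j -> cnt S i = cnt S j -> p i < p j.
Proof.
apply: (cnt_chain (g := fun i => p i)) => w w' e wS.
by rewrite -(ordS_lt e); apply: pS.
Qed.

(** The arc runs from [j] up to [L] and then from 0 up to [i], with [p] increasing along it. *)
Lemma chain_wrap i j : cnt S i = 0 -> cnt S j = #|S| -> p j < p i.
Proof.
move=> ci cj; have LS := max_notin cj.
have p0 : p ord0 <= p i.
  case: (posnP i) => [i0|i0]; first by rewrite (_ : i = ord0) //; apply/val_inj.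
  by apply/ltnW/chain_lt; rewrite ?cnt0.
have pL : p j <= p L.
  case: (eqVneq j L) => [->//|jL]; apply/ltnW/chain_lt.
    by move: jL; rewrite -val_eqE /=; have := ltn_ord j; lia.
  by have := cnt_ordmax; rewrite (negbTE LS) cj addn0.
by have := pS LS; rewrite ordS_max; lia.
Qed.

Lemma first_start y : p y = ord0 -> ord_pred y \in S.
Proof. by move=> py; apply: contraT => /pS; rewrite ord_predK py. Qed.

End Chain.
End Arcs.
End Core.

(** * Permutations as transversals of row assignments *)

Section Transversals.
Variable m : nat.
Local Notation n := m.+2.
Local Notation L := (@ord_max m.+1).
Implicit Types (p s g r : {perm 'I_n}) (i j u v w y : 'I_n) (S D : {set 'I_n}).

(** Since [f (r v) = f v], exchanging [v] and [r v] after [r] does not affect [f]. The resulting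
    [r'] fixes both [u] and [v], so it commutes with their transposition. *)
Lemma tperm_conj (A f f' : 'I_n -> nat) r u v :
  (forall i, A (r i) = A i) -> (forall i, f' i = f (r i)) ->
  r u = u -> f' v = f v ->
  exists r', (forall i, A (r' i) = A i) /\
    forall i, f' (tperm u v i) = f (tperm u v (r' i)).
Proof.
move=> Ar ff ru fv; pose r' := (r * tperm v (r v))%g.
have r'v : r' v = v by rewrite permM tpermR.
have r'u : r' u = u.
  rewrite permM ru; case: (eqVneq u v) => [<-|uv]; first by rewrite ru tpermL.
  by rewrite tpermD 1?eq_sym //; apply: contra uv => /eqP e; rewrite -(inj_eq (@perm_inj _ r)) ru e.
exists r'; split=> i.
  by rewrite permM; case: tpermP => [e|/perm_inj->|_ _] //; rewrite Ar -e Ar.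
have -> : f' (tperm u v i) = f (r' (tperm u v i)).
  by move: (tperm u v i) => k; rewrite ff permM; case: tpermP => [->|->|//]; rewrite -ff fv.
congr f; case: (eqVneq i u) => [->|iu]; first by rewrite r'u tpermL r'v.
case: (eqVneq i v) => [->|iv]; first by rewrite r'v tpermR r'u.
have nu : u != r' i by rewrite -{1}r'u (inj_eq (@perm_inj _ r')) eq_sym.
have nv : v != r' i by rewrite -{1}r'v (inj_eq (@perm_inj _ r')) eq_sym.
by rewrite !tpermD // eq_sym.
Qed.

Variable row : 'I_n -> nat.
Hypothesis row_mono : forall u v, u < v -> row u <= row v.
Hypothesis row_max : forall u, u != L -> row u < row L.

Lemma row_le_max u : row u <= row L.
Proof. by case: (eqVneq u L) => [->|/row_max/ltnW]. Qed.

Lemma row_eq_max u : row L <= row u -> u = L.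
Proof. by move=> le; apply/eqP; apply: contraT => /row_max; rewrite ltnNge le. Qed.

Lemma row_lt u v : row u < row v -> u < v.
Proof. by case: (ltngtP u v) => // [/row_mono|/val_inj->]; lia. Qed.

(** For [row := rowJ J] this is the bound [idesc s \subset J], by [row_increasingP]. *)
Definition row_increasing s :=
  forall i j, row (s i) = row (s j) -> i < j -> s i < s j.

Lemma row_increasing_lt s i j : row_increasing s ->
  (s i < s j) = (row (s i) < row (s j)) || (row (s i) == row (s j)) && (i < j).
Proof.
move=> si; case: (ltngtP (row (s i)) (row (s j))) => [/row_lt-> //|/row_lt|e] /=; first lia.
case: (ltngtP i j) => [/(si _ _ e)//|/(si _ _ (esym e))|/val_inj->]; last by rewrite ltnn.
by case: ltngtP.
Qed.

Lemma row_increasing_inj s s' : row_increasing s -> row_increasing s' ->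
  (forall i, row (s i) = row (s' i)) -> s = s'.
Proof.
by move=> si si' e; apply: perm_lt_inj => i j; rewrite !row_increasing_lt // !e.
Qed.

(** [s] ranks positions by row, then by place. Rows are kept because [row] and its rearrangement
    along [s] are both sorted. *)
Lemma standardize g :
  exists2 s, row_increasing s & forall i, row (s i) = row (g i).
Proof.
have [|||s sP] := @perm_of_order _ (lex (row \o g) (fun i j => i < j)).
- by apply: lex_irr => i; rewrite ltnn.
- by apply: lex_trans => j i k; apply: ltn_trans.
- by apply: lex_total => i j; rewrite -val_eqE neq_ltn.
have rowE i : row (s i) = row (g i).
  have := @sorted_perm_eq _ (fun=> 0) row (s^-1 * g)%g 0 (fun=> erefl)
    (fun i j _ _ => @row_mono i j) _ (s i) erefl.
  rewrite permM permK => -> // {i} u v _ _ uv.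
  have := sP (s^-1%g u) (s^-1%g v); rewrite !permKV uv /lex /= !permM; lia.
exists s => // i j; rewrite !rowE => e ij.
by rewrite sP /lex /= e eqxx ij orbT.
Qed.

Section Equiv.
Variable S : {set 'I_n}.

(** A row assignment is represented by any permutation [g] inducing it as [row \o g], which fixes
    the size of each row in advance. *)
Definition equivS : rel {perm 'I_n} := fun g g' =>
  [exists r : {perm 'I_n}, [forall i,
     (arc S (r i) == arc S i) && (row (g' i) == row (g (r i)))]].

Lemma equivSP g g' :
  reflect (exists r, (forall i, arc S (r i) = arc S i) /\
                     forall i, row (g' i) = row (g (r i))) (equivS g g').
Proof.
apply: (iffP existsP) => [[r /forallP H]|[r [Ar gr]]]; exists r.
  by split=> i; have /andP[/eqP ? /eqP] := H i.
by apply/forallP => i; rewrite Ar gr !eqxx.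
Qed.

Lemma equivS_sym : ssrbool.symmetric equivS.
Proof.
suff sym g g' : equivS g g' -> equivS g' g by move=> g g'; apply/idP/idP; apply: sym.
case/equivSP => r [Ar gr]; apply/equivSP; exists r^-1%g; split=> i.
  by rewrite -[in RHS](permKV r i) Ar.
by rewrite gr permKV.
Qed.

Lemma equivS_trans : transitive equivS.
Proof.
move=> g2 g1 g3 /equivSP[r [Ar gr]] /equivSP[r' [Ar' gr']].
apply/equivSP; exists (r' * r)%g; split=> i; first by rewrite permM Ar Ar'.
by rewrite permM gr' gr.
Qed.

(* Inside an arc not containing [L], [p] runs first through the values of
   [normp p] that are at least its value at [y], then through the smaller ones.
   With [k] the row of [y] and [c] its arc, [wrapV c k x] renumbers the rows in
   this order; in the arc [x] of [L] the natural order of positions already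
   follows [normp p]. *)
Definition wrapV (c k x v : nat) :=
  if x == arc S L then v
  else v + ((v < k) || (v == k) && (x < c)) * (row L).+1.

(* The positions reached from [L] by wrapping around inside its arc. *)
Definition post i := (arc S i == arc S L) && (cnt S i != cnt S L).

Lemma postP i : post i -> cnt S i = 0 /\ cnt S L = #|S|.
Proof.
case/andP => /eqP/arc_eq[->|[e e']|[e e']]; rewrite ?eqxx // => _.
by have := cnt_le_max S i; rewrite e e'; lia.
Qed.

Lemma start_not_post y i : ord_pred y \in S -> post i -> i < y.
Proof.
move=> yS /postP[ci cL]; have := start_cnt_gt0 yS (max_notin cL).
by case: (ltnP i y) => // /(@cnt_le _ S); rewrite ci; lia.
Qed.

Lemma start_le_pre y i : ord_pred y \in S -> cnt S i = cnt S L -> y <= i.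
Proof.
move=> yS ci; case: (leqP y i) => // /(start_cnt yS).
by have := cnt_le_max S y; lia.
Qed.

Lemma arc_lin i : arc S i != arc S L -> arc S i = cnt S i.
Proof.
rewrite /arc => ne; rewrite modn_small //; case: ltngtP (cnt_max S i) => // e _.
case/negP: ne; have := cnt_le_max S i; have := cnt_max S L => *.
by rewrite (_ : cnt S i = cnt S L) //; lia.
Qed.

(** An arc other than that of [L] is an interval, and it lies entirely on one side of the start [y];
    this is what the test [x < c] in [wrapV] detects. *)
Lemma start_lin y i : ord_pred y \in S -> arc S i != arc S L ->
  (i < y) = (arc S i < cnt S y).
Proof.
move=> yS /arc_lin->; case: (ltnP i y) => [/(start_cnt yS)->//|].
by move/(@cnt_le _ S); case: ltngtP.
Qed.

Section OnePerm.
Variables (p : {perm 'I_n}) (y : 'I_n).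
Hypotheses (py : p y = ord0) (pS : forall i, i \notin S -> p i < p (ordS i)).
Let s := normp p.
Hypothesis s_incr : row_increasing s.
Let yS := first_start pS py.

(** [L] carries the largest value of [s], the last one in the first run of [p]; as [p i <= p L], the
    position [i] is in that run too. *)
Lemma pre_ge i : cnt S i = cnt S L -> s y <= s i.
Proof.
move=> ci; case: (eqVneq i L) => [->|iL]; first by rewrite normp_max -ltnS.
have : p i < p L.
  by apply: (chain_lt pS) => //; move: iL; rewrite -val_eqE /=; have := ltn_ord i; lia.
rewrite (normp_lt _ _ py) -/s normp_max; have := ltn_ord (s y); have := ltn_ord (s i).
by case: (ltnP (s i) (s y)) => //= *; lia.
Qed.

(** Here [p L < p i], and [L] ends the first run of [p], so [i] belongs to the second. *)
Lemma post_lt i : post i -> s i < s y.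
Proof.
move=> /[dup] iP /postP[ci cL]; have := chain_wrap pS ci cL.
rewrite (normp_lt _ _ py) -/s normp_max; have := ltn_ord (s y); have := ltn_ord (s i).
by case: (ltnP (s i) (s y)) => //= *; lia.
Qed.

Lemma lt_start_row i : (s i < s y) = (row (s i) < row (s y)) || (row (s i) == row (s y)) && (i < y).
Proof. exact: row_increasing_lt. Qed.

Lemma wrapV_sorted i j : i < j -> arc S i = arc S j ->
  wrapV (cnt S y) (row (s y)) (arc S i) (row (s i)) <=
  wrapV (cnt S y) (row (s y)) (arc S j) (row (s j)).
Proof.
move=> ij e; rewrite /wrapV -e; case: eqP => [eL|/eqP neL].
  case: (boolP (post i)) => pi; case: (boolP (post j)) => pj.
  - have [ci _] := postP pi; have [cj _] := postP pj.
    have := chain_lt pS ij; rewrite ci cj => /(_ erefl).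
    rewrite (normp_lt _ _ py) -/s !post_lt //= => /row_mono //.
  - have := post_lt pi; have := @pre_ge j; move: pj.
    rewrite /post -e eL eqxx negbK => /eqP -> /(_ erefl) le lt.
    by apply: row_mono; lia.
  (* Impossible: wrapped positions precede [y], those on the level of [L] do not. *)
  - have := start_not_post yS pj.
    move: pi; rewrite /post eL eqxx negbK => /eqP ci; have := start_le_pre yS ci; lia.
  - move: pi pj; rewrite /post -e eL eqxx !negbK => /eqP ci /eqP cj.
    have := chain_lt pS ij; rewrite ci cj => /(_ erefl).
    have := pre_ge ci; have := pre_ge cj.
    by rewrite (normp_lt _ _ py) -/s => *; apply: row_mono; lia.
have eij : cnt S i = cnt S j by rewrite -(arc_lin neL) e arc_lin // -e.
(* The flag in [wrapV] records whether [s u] belongs to the second run of [p]. *)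
have bE u : arc S u = arc S i -> (row (s u) < row (s y)) ||
    (row (s u) == row (s y)) && (arc S i < cnt S y) = (s u < s y).
  by move=> eu; rewrite lt_start_row (start_lin yS) ?eu.
rewrite !bE //; have := chain_lt pS ij eij; rewrite (normp_lt _ _ py) -/s.
have := @row_mono (s i) (s j); have := row_le_max (s i).
by case: (s i < s y); case: (s j < s y) => //=; lia.
Qed.

(** After the exchange, [L] carries the row of [s y], and in the arc of [L] this row has rank the
    number of wrapped positions. That number depends on [S] alone, so the row can be recovered from
    the class. *)
Lemma start_row_rank :
  #|[set i | (arc S i == arc S L) && (row (s (tperm y L i)) < row (s y))]| <=
  #|[set i | post i]| <
  #|[set i | (arc S i == arc S L) && (row (s (tperm y L i)) <= row (s y))]|.
Proof.
have nLP : ~~ post L by rewrite /post !eqxx.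
apply/andP; split.
  apply/subset_leq_card/subsetP => i; rewrite !inE /post => /andP[-> /=].
  apply: contraTN => /eqP ci; rewrite -leqNgt.
  case: tpermP => [_|_|_ _]; rewrite ?leqnn ?normp_max ?row_le_max //.
  have := pre_ge ci; rewrite leq_eqVlt => /predU1P[/val_inj->//|]; exact: row_mono.
apply: proper_card; apply/properP; split; last first.
  by exists L; rewrite !inE // tpermR eqxx leqnn.
apply/subsetP => i; rewrite !inE => iP; have /andP[-> _] /= := iP.
rewrite tpermD; first exact/row_mono/post_lt.
  by rewrite -val_eqE neq_ltn (start_not_post yS iP) orbT.
by apply: contraNneq nLP => ->.
Qed.

End OnePerm.

(** The class determines in turn the row of the value at [y], the position [y], all rows by sorting
    each arc, and finally the permutation. *)
Lemma rot_transversal_inj p1 p2 y1 y2 :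
  p1 y1 = ord0 -> p2 y2 = ord0 ->
  (forall i, i \notin S -> p1 i < p1 (ordS i)) ->
  (forall i, i \notin S -> p2 i < p2 (ordS i)) ->
  row_increasing (normp p1) -> row_increasing (normp p2) ->
  equivS (tperm y1 L * normp p1)%g (tperm y2 L * normp p2)%g -> p1 = p2.
Proof.
have rank (q1 q2 : {perm 'I_n}) (z1 z2 : 'I_n) :
    q1 z1 = ord0 -> q2 z2 = ord0 ->
    (forall i, i \notin S -> q1 i < q1 (ordS i)) ->
    (forall i, i \notin S -> q2 i < q2 (ordS i)) ->
    row_increasing (normp q1) -> row_increasing (normp q2) ->
    equivS (tperm z1 L * normp q1)%g (tperm z2 L * normp q2)%g ->
    row (normp q2 z2) <= row (normp q1 z1).
  move=> q1z q2z q1S q2S q1i q2i /equivSP[r [Ar qr]].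
  have /andP[_ lt] := start_row_rank q1z q1S.
  have /andP[le _] := start_row_rank q2z q2S.
  rewrite leqNgt; apply/negP => ltj; move: (leq_ltn_trans le lt); rewrite ltnNge => /negP[].
  rewrite -(card_preimset _ (@perm_inj _ r)); apply/subset_leq_card/subsetP => i.
  rewrite !inE Ar => /andP[-> /=]; have := qr i; rewrite !permM => ->.
  by move/leq_ltn_trans; apply.
move=> p1y p2y p1S p2S p1i p2i E.
have ej : row (normp p1 y1) = row (normp p2 y2).
  apply/eqP; rewrite eqn_leq (rank p2 p1) // 1?equivS_sym // (rank p1 p2) //.
have /equivSP[r [Ar gr]] := E.
(* After the exchange, [y1] and [y2] hold the unique entry of the last row. *)
have ry : r y2 = y1.
  have := gr y2; rewrite !permM tpermL normp_max => e.
  have : normp p1 (tperm y1 L (r y2)) = L by apply: row_eq_max; rewrite -e.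
  rewrite -[X in _ = X](normp_max p1) => /perm_inj; rewrite -{2}(tpermL y1 L).
  exact: perm_inj.
have yy : y1 = y2.
  by apply: (start_inj (S := S)); [exact: (first_start p1S p1y) | exact: (first_start p2S p2y) | rewrite -ry Ar].
subst y2.
(* Undo the exchange of [y1] and [L] on both sides. *)
have [r' [Ar' hr']] : exists r', (forall i, arc S (r' i) = arc S i) /\
    forall i, row (normp p2 i) = row (normp p1 (r' i)).
  have ff i : row (normp p2 (tperm y1 L i)) = row (normp p1 (tperm y1 L (r i))).
    by have := gr i; rewrite !permM.
  have fL : row (normp p2 (tperm y1 L L)) = row (normp p1 (tperm y1 L L)) by rewrite tpermR.
  have [r' [Ar' hr']] := tperm_conj (f := fun i => row (normp p1 (tperm y1 L i)))
    (f' := fun i => row (normp p2 (tperm y1 L i))) Ar ff ry fL.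
  by exists r'; split=> // i; have := hr' i; rewrite !tpermK.
have rowE i : row (normp p2 i) = row (normp p1 i).
  have := @sorted_perm_eq _ (arc S)
    (fun i => wrapV (cnt S y1) (row (normp p1 y1)) (arc S i) (row (normp p1 i)))
    r' (arc S i) Ar' _ _ i erefl.
  rewrite /= Ar' -hr'; move=> H.
  have {H} : wrapV (cnt S y1) (row (normp p1 y1)) (arc S i) (row (normp p2 i)) =
             wrapV (cnt S y1) (row (normp p1 y1)) (arc S i) (row (normp p1 i)).
    apply: H => u v ui vi uv.
      by apply: wrapV_sorted => //; rewrite ui vi.
    by rewrite !Ar' -!hr' ej; apply: wrapV_sorted => //; rewrite ui vi.
  rewrite /wrapV; case: eqP => // _.
  (* The amount added by [wrapV] exceeds every row number, so the row can be read off. *)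
  have := row_le_max (normp p1 i); have := row_le_max (normp p2 i).
  case: (_ || _ && _); case: (_ || _ && _) => /=; lia.
have es : normp p1 = normp p2 by apply: row_increasing_inj.
by apply/permP => i; rewrite (normpK _ p1y) (normpK _ p2y) es.
Qed.

(** Two sortings reconstruct the rows: [r1] finds the entries to be exchanged between [y] and [L],
    and [r2] orders the rest as [p] must run through them. *)
Lemma rot_transversal_surj g : 0 < #|S| -> exists p y,
  [/\ p y = ord0, forall i, i \notin S -> p i < p (ordS i),
      row_increasing (normp p) & equivS (tperm y L * normp p)%g g].
Proof.
move=> S_gt0; have [y yS ay] := arc_start (g^-1%g L) S_gt0.
have post_neL i : post i -> i != L by apply: contraTneq => ->; rewrite /post !eqxx.
have post_ney i : post i -> i != y.
  by move=> iP; rewrite -val_eqE neq_ltn (start_not_post yS iP).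
(* Order for the first sorting: wrapped positions, then [L], which thereby gets the entry of the
   rank found in [start_row_rank], then the others, and [y] at the end to receive the last row. The
   constants keep these ranges disjoint. *)
pose O1 i := if i == y then 3 * n else if post i then (i : nat) else if i == L then n else n.+1 + i.
have injO1 : injective O1.
  move=> i j; rewrite /O1; have := ltn_ord i; have := ltn_ord j => lj li.
  case: (i =P y) => [/(congr1 val) /= ?|_]; case: (j =P y) => [/(congr1 val) /= ?|_];
  case: (post i); case: (post j); case: (i =P L) => [/(congr1 val) /= ?|_];
  case: (j =P L) => [/(congr1 val) /= ?|_] e; apply/val_inj; rewrite /=; lia.
have [r1 [Ar1 sort1]] := sort_perm (arc S) (row \o g) injO1.
pose f1 i := row (g (r1 i)).
have {}sort1 i j : arc S i = arc S j -> O1 i < O1 j -> f1 i <= f1 j by exact: sort1.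
have f1y : f1 y = row L.
  apply/eqP; rewrite eqn_leq row_le_max /=.
  have e : f1 (r1^-1%g (g^-1%g L)) = row L by rewrite /f1 !permKV.
  rewrite -e; set z := r1^-1%g _.
  have az : arc S z = arc S y by rewrite ay -Ar1 permKV.
  case: (eqVneq z y) => [->//|zy]; apply: sort1 => //.
  by rewrite /O1 eqxx (negbTE zy); have := ltn_ord z; do 2?case: ifP => _; lia.
(* The row that the value at [y] will have once [y] and [L] are exchanged. *)
pose k := f1 L.
have f1_post i : post i -> f1 i <= k.
  move=> iP; have /andP[/eqP ai _] := iP; apply: sort1 => //.
  rewrite /O1 (negbTE (post_ney _ iP)) iP eqxx /post !eqxx /=.
  by have := ltn_ord i; case: ifP => _; rewrite ?andbF; lia.
have f1_pre i : cnt S i = cnt S L -> k <= f1 i.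
  move=> ci; case: (eqVneq i L) => [->//|iL].
  have iN : ~~ post i by rewrite /post ci eqxx andbF.
  have yL : L != y.
    apply: contra iL => /eqP yL; rewrite -val_eqE /= eqn_leq -ltnS ltn_ord /=.
    by have := start_le_pre yS ci; rewrite -yL.
  apply: sort1; first by rewrite /arc ci.
  by rewrite /O1 (negbTE yL) eqxx (negbTE iN) (negbTE iL) /post !eqxx /=; case: ifP => _; lia.
pose g1 := (tperm y L * r1 * g)%g.
pose h i := row (g1 i).
have hE i : h i = f1 (tperm y L i) by rewrite /h !permM.
have hL : h L = row L by rewrite hE tpermR.
have hy : h y = k by rewrite hE tpermL.
have hD i : i != y -> i != L -> h i = f1 i by move=> *; rewrite hE tpermD 1?eq_sym.
have h_post i : post i -> h i = f1 i by move=> iP; rewrite hD ?post_ney ?post_neL.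
have h_pre i : cnt S i = cnt S L -> k <= h i.
  move=> ci; case: (eqVneq i L) => [->|iL]; first by rewrite hL row_le_max.
  by case: (eqVneq i y) => [->|iy]; rewrite ?hy // hD // f1_pre.
have h_sorted i j : arc S i = arc S L -> arc S j = arc S L -> i < j -> h i <= h j.
  move=> ai aj ij; case: (eqVneq j L) => [->|jL]; first by rewrite hL row_le_max.
  have iL : i != L by rewrite -val_eqE /=; have := ltn_ord j; lia.
  have cP u : arc S u = arc S L -> ~~ post u -> cnt S u = cnt S L.
    by move=> au; rewrite /post au eqxx negbK => /eqP.
  case: (boolP (post i)) => iP; case: (boolP (post j)) => jP.
  - rewrite !h_post //; apply: sort1; first by rewrite ai aj.
    by rewrite /O1 !(negbTE (post_ney _ _)) // iP jP.
  - by rewrite (h_post i) //; apply: leq_trans (f1_post _ iP) (h_pre _ (cP _ aj jP)).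
  - by have := start_not_post yS jP; have := start_le_pre yS (cP _ ai iP); lia.
  - case: (eqVneq i y) => [->|iy]; first by rewrite hy h_pre // cP.
    have yi : y < i.
      by have := start_le_pre yS (cP _ ai iP); rewrite leq_eqVlt val_eqE eq_sym (negbTE iy).
    have jy : j != y by rewrite -val_eqE /=; lia.
    rewrite !hD //; apply: sort1; first by rewrite ai aj.
    by rewrite /O1 (negbTE iy) (negbTE jy) (negbTE iP) (negbTE jP) (negbTE iL) (negbTE jL); lia.
pose V i := wrapV (cnt S y) k (arc S i) (h i).
have [r2 [Ar2 sort2]] := sort_perm (arc S) V (@ord_inj n).
pose h' i := h (r2 i).
have {}sort2 i j : arc S i = arc S j -> i < j ->
    wrapV (cnt S y) k (arc S i) (h' i) <= wrapV (cnt S y) k (arc S j) (h' j).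
  by move=> e ij; have := sort2 i j e ij; rewrite /V !Ar2.
have h'a i : arc S i = arc S L -> h' i = h i.
  apply: (sorted_perm_eq Ar2 h_sorted) => u v au av uv.
  by have := sort2 u v; rewrite au av /wrapV eqxx; apply.
have h'y : h' y = k.
  (* Otherwise [y] is the first position of its arc, and [k], an entry of that arc, is minimal for
     the order given by [wrapV]. *)
  case: (eqVneq (arc S y) (arc S L)) => [/h'a->//|ny].
  have wy : wrapV (cnt S y) k (arc S y) k = k.
    by rewrite /wrapV (negbTE ny) arc_lin // !ltnn andbF addn0.
  pose u := r2^-1%g y; have au : arc S u = arc S y by rewrite -Ar2 permKV.
  have h'u : h' u = k by rewrite /h' permKV.
  have : wrapV (cnt S y) k (arc S y) (h' y) <= k.
    case: (ltngtP u y) => [uy|yu|/val_inj uy]; last by rewrite (_ : h' y = k) ?wy // -uy.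
      have := start_cnt yS uy; have := au; rewrite arc_lin ?au // arc_lin //; lia.
    by apply: leq_trans (sort2 _ _ (esym au) yu) _; rewrite au h'u wy.
  rewrite /wrapV (negbTE ny); have : k <= row L by apply: row_le_max.
  by case: (ltngtP (h' y) k) => //=; lia.
(* The unique entry of the last row is at [L] before and after the second sorting. *)
have r2L : r2 L = L.
  have : h' L = row L by rewrite h'a.
  rewrite /h' /h => e; apply: (@perm_inj _ g1).
  by rewrite (row_eq_max (u := g1 L)) -/(h L) ?hL // (row_eq_max (u := g1 (r2 L))) // e.
have [r3 [Ar3 hr3]] := tperm_conj (f := h) (f' := h') Ar2 (fun=> erefl) r2L (etrans h'y (esym hy)).
have {}hr3 i : h' (tperm y L i) = row (g (r1 (r3 i))).
  by rewrite tpermC hr3 hE tpermC tpermK.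
have [s si sE] := standardize (r2 * g1)%g.
have {}sE i : row (s i) = h' i by rewrite sE permM.
have sL : s L = L by apply: row_eq_max; rewrite sE h'a ?hL.
(* Rotate the values so that the one at [y] becomes 0; as [s] fixes [L], normalizing gives [s]
   back. *)
pose p := (s * rotp (- s y)%R)%g.
have pE i : p i = (s i - s y)%R by rewrite permM permE.
have py : p y = ord0 by rewrite pE GRing.subrr.
have ps : normp p = s.
  by apply/permP => i; rewrite normpE !pE sL GRing.subKr GRing.subrK.
exists p, y; split=> //; last 2 first.
- by rewrite ps.
- rewrite ps equivS_sym; apply/equivSP; exists (r3 * r1)%g; split=> i.
    by rewrite permM Ar1 Ar3.
  by rewrite !permM sE hr3.
move=> i iS.
have bE u : (s u < s y) = (h' u < k) || (h' u == k) && (u < y).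
  by rewrite row_increasing_lt // !sE h'y.
have b_post u : post u -> s u < s y.
  move=> uP; have /andP[/eqP au _] := uP.
  rewrite bE h'a // h_post // (start_not_post yS uP) andbT orbC -leq_eqVlt; exact: f1_post.
have b_pre u : cnt S u = cnt S L -> (s u < s y) = false.
  move=> cu; rewrite bE h'a /arc ?cu //.
  by have := h_pre _ cu; have := start_le_pre yS cu; lia.
rewrite (normp_lt _ _ py) ps.
case: (eqVneq i L) => [iL|iL].
  have LS : L \notin S by rewrite -iL.
  (* The arc of [L] continues at 0, so going from [L] to 0 passes from the first run of [p] to the
     second. *)
  have p0 : post ord0.
    rewrite /post -(ordS_max m) arc_ordS // eqxx andTb ordS_max cnt0.
    by have := cnt_ordmax S; rewrite (negbTE LS); lia.
  by rewrite iL ordS_max b_pre // b_post.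
have lt : i.+1 < n by move: iL; rewrite -val_eqE /=; have := ltn_ord i; lia.
have ei := @ordS_lt _ i (Ordinal lt) erefl.
have aS := arc_ordS iS; rewrite ei in aS *; set i' := Ordinal lt in ei aS *.
have ii' : i < i' by rewrite /=.
have ci' : cnt S i' = cnt S i by rewrite /= cntS (negbTE iS) addn0.
have := sort2 _ _ (esym aS) ii'; rewrite aS /wrapV.
case: eqP => [aL|/eqP naL] le.
  have -> : s i < s i' by rewrite row_increasing_lt // !sE; lia.
  case: (boolP (post i)) => iP.
    by rewrite !b_post //; move: iP; rewrite /post aS ci'.
  by move: iP; rewrite /post aL eqxx negbK => /eqP iP; rewrite !b_pre ?ci'.
have wE u : arc S u = arc S i ->
    (h' u < k) || (h' u == k) && (arc S i < cnt S y) = (s u < s y).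
  by move=> eu; rewrite bE (start_lin yS) ?eu.
move: le; rewrite !wE // (row_increasing_lt i i' si) !sE ii' andbT.
have : h' i' <= row L by exact: row_le_max.
by case: (s i < s y); case: (s i' < s y) => //=; lia.
Qed.

End Equiv.
End Transversals.

(** * Inclusion-exclusion *)

(** Split the count for the bound [S] by the exact set; by induction on [#|S|] the contributions of
    proper subsets agree and cancel. *)
Lemma card_sub_moebius (X Y T : finType) (P : pred X) (Q : pred Y)
    (a : X -> {set T}) (b : Y -> {set T}) :
  (forall S : {set T}, #|[set x | P x && (a x \subset S)]| = #|[set y | Q y && (b y \subset S)]|) ->
  forall S : {set T}, #|[set x | P x && (a x == S)]| = #|[set y | Q y && (b y == S)]|.
Proof.
have sumE (Z : finType) (O : pred Z) (c : Z -> {set T}) (S : {set T}) :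
    #|[set z | O z && (c z \subset S)]| =
    #|[set z | O z && (c z == S)]| + \sum_(E : {set T} | E \proper S) #|[set z | O z && (c z == E)]|.
  have cE (E : {set T}) : #|[set z | O z && (c z == E)]| = \sum_(z | O z && (c z == E)) 1.
    by rewrite cardsE -sum1_card.
  have -> : #|[set z | O z && (c z \subset S)]| = \sum_(z | O z && (c z \subset S)) 1.
    by rewrite cardsE -sum1_card.
  rewrite (partition_big c (fun E : {set T} => E \subset S)) => [|z /andP[]//].
  rewrite (bigD1 S) //= cE; congr (_ + _).
    by apply: eq_bigl => z; case: eqP => [->|]; rewrite ?subxx ?andbT ?andbF.
  apply: eq_big => [E|E /andP[ES _]]; first by rewrite properEneq andbC.
  by rewrite cE; apply: eq_bigl => z; case: eqP => [->|]; rewrite ?ES ?andbT ?andbF.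
move=> eqS S; have [k] := ubnP #|S|; elim: k S => // k IH S ltk.
have := eqS S; rewrite !sumE => /eqP.
rewrite (eq_bigr (fun E => #|[set y | Q y && (b y == E)]|)) ?eqn_add2r => [/eqP //|E /proper_card lt].
by apply: IH; lia.
Qed.

(** * Equidistribution of descents and rotation invariance of cyclic descents *)

Section Equidistribution.
Variable m : nat.
Local Notation n := m.+2.
Local Notation L := (@ord_max m.+1).
Implicit Types (p s g r : {perm 'I_n}) (i j u v w y : 'I_n) (S D J I E : {set 'I_n}).

(** The bound [i.+2 < n] leaves out the pair formed by the two largest values. *)
Definition idesc s : {set 'I_n} :=
  [set i : 'I_n | (i.+2 < n) && (s^-1%g (ordS i) < s^-1%g i)].

Lemma in_invDesClass J s : (s \in invDesClass J) = (s L == L) && (idesc s == J).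
Proof.
rewrite inE; congr (_ && _).
  apply/forallP/eqP => [/(_ L)|sL i]; first by rewrite eqxx => /eqP.
  by apply/implyP => /eqP ei; have -> : i = L by [apply/val_inj]; rewrite sL.
congr (_ == _); apply/setP => i; rewrite !inE; case: ltnP => //= lt.
apply/existsP/idP => [[j /andP[/eqP ej]]|lt']; first by rewrite (ordS_lt ej).
by exists (ordS i); rewrite lt' /= modn_small ?eqxx // ltnW.
Qed.

(** [normp p] is the only element of the coset of [p] that fixes [L]. *)
Lemma in_rotClass J p : (p \in rotClass (invDesClass J)) = (idesc (normp p) == J).
Proof.
rewrite inE; apply/existsP/idP.
  case=> k /existsP[s /andP[]]; rewrite in_invDesClass => /andP[/eqP sL /eqP <-].
  move/forallP => ps; have pE i : p i = (s i + k)%R by apply/val_inj/eqP; apply: (ps i).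
  suff -> : normp p = s by [].
  by apply/permP => i; rewrite normpE !pE sL GRing.opprD GRing.addNKr GRing.addrK.
move=> pJ; exists (p L - L)%R; apply/existsP; exists (normp p).
rewrite in_invDesClass normp_max eqxx pJ /=; apply/forallP => i.
have -> : p i = (normp p i + (p L - L))%R by rewrite normpE -GRing.opprB GRing.subrK.
by rewrite /=.
Qed.

(* The extra cut puts the largest value in a row of its own. *)
Definition rowJ J v := cnt (J :|: [set i : 'I_n | i.+2 == n]) v.

Lemma rowJ_mono J u v : u < v -> rowJ J u <= rowJ J v.
Proof. by move=> /ltnW; apply: cnt_le. Qed.

Lemma rowJ_max J u : u != L -> rowJ J u < rowJ J L.
Proof.
move=> uL; have lm : m < n by [].
have := cntS (J :|: [set i : 'I_n | i.+2 == n]) (Ordinal lm).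
rewrite !inE eqxx orbT /rowJ /= => ->; rewrite addn1 ltnS; apply: cnt_le.
by move: uL; rewrite -val_eqE /=; have := ltn_ord u; lia.
Qed.

Lemma rowJ_succ J i : i.+1 < n ->
  rowJ J (ordS i) = rowJ J i + ((i \in J) || (i.+2 == n)).
Proof. by move=> lt; rewrite /rowJ /= modn_small // cntS !inE. Qed.

(** Rows are the intervals of values between cuts, and the extra cut of [rowJ] sits at the pair that
    [idesc] ignores. *)
Lemma row_increasingP J s : reflect (row_increasing (rowJ J) s) (idesc s \subset J).
Proof.
apply: (iffP subsetP) => [sJ|si].
  have chain u v : u < v -> rowJ J u = rowJ J v -> s^-1%g u < s^-1%g v.
    apply: (cnt_chain (g := fun u => s^-1%g u)) => w w' e; rewrite !inE negb_or => /andP[wJ w2].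
    have lt : w.+2 < n by have := ltn_ord w'; move: w2; lia.
    case: ltngtP => // [lt'|/val_inj/perm_inj ww']; last by rewrite ww' in e; lia.
    by case/negP: wJ; apply: sJ; rewrite inE lt (ordS_lt e).
  move=> i j e ij; case: ltngtP => // [lt|/val_inj/perm_inj eij]; last by rewrite eij ltnn in ij.
  by have := chain _ _ lt (esym e); rewrite !permK; lia.
move=> i; rewrite inE => /andP[lt lt']; apply: contraTT lt' => iJ.
rewrite -leqNgt leqNgt; apply/negP => lt'.
have := si _ _ _ lt'; rewrite !permKV rowJ_succ; last by lia.
have -> : (i.+2 == n) = false by lia.
by rewrite (negbTE iJ) addn0 => /(_ erefl) /=; rewrite modn_small; lia.
Qed.

Definition rot_rep p := (tperm (p^-1%g ord0) L * normp p)%g.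

Lemma rot_rep_inj J S :
  {in [set p | (idesc (normp p) \subset J) && (perm_cDes p \subset S)] &,
    forall p q, equivS (rowJ J) S (rot_rep p) (rot_rep q) -> p = q}.
Proof.
move=> p q; rewrite !inE => /andP[/row_increasingP pi /cDes_subP pS].
move=> /andP[/row_increasingP qi /cDes_subP qS].
by apply: (rot_transversal_inj (@rowJ_mono J) (@rowJ_max J)); rewrite ?permKV.
Qed.

Lemma rot_rep_surj J S : 0 < #|S| -> forall g,
  exists2 p, p \in [set p | (idesc (normp p) \subset J) && (perm_cDes p \subset S)]
           & equivS (rowJ J) S (rot_rep p) g.
Proof.
move=> S0 g; have [p [y [py pS pi E]]] := rot_transversal_surj (@rowJ_mono J) (@rowJ_max J) g S0.
exists p; first by rewrite inE; apply/andP; split; [apply/row_increasingP|apply/cDes_subP].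
by rewrite /rot_rep -py permK.
Qed.

Lemma arc_id S i : L \in S -> arc S i = cnt S i.
Proof.
move=> LS; rewrite /arc modn_small //.
by have := cnt_ordmax S; have := cnt_le_max S i; rewrite LS; lia.
Qed.

Lemma ordS_val S i : L \in S -> i \notin S -> ordS i = i.+1 :> nat.
Proof.
move=> LS iS; have iL : i != L by apply: contra iS => /eqP->.
rewrite /= modn_small //; move: iL; rewrite -val_eqE /=; have := ltn_ord i; lia.
Qed.

(** When [L] is a cut no arc wraps around, so the rows of [p] are the sorted arrangement on each
    arc, and they determine [p]. *)
Lemma lin_inj J S : L \in S ->
  {in [set p | (idesc p \subset J) && (perm_cDes p \subset S)] &,
    forall p q, equivS (rowJ J) S p q -> p = q}.
Proof.
move=> LS p q; rewrite !inE => /andP[/row_increasingP pi /cDes_subP pS].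
move=> /andP[/row_increasingP qi /cDes_subP qS] /equivSP[r [Ar gr]].
apply: (row_increasing_inj (@rowJ_mono J)) => // i; rewrite gr.
apply/esym; apply: (sorted_perm_eq (f := fun i => rowJ J (p i)) Ar (x := arc S i)) => // u v au av uv.
  by apply/rowJ_mono/(chain_lt pS uv); rewrite -!arc_id ?au.
by rewrite -!gr; apply/rowJ_mono/(chain_lt qS uv); rewrite -!arc_id ?au.
Qed.

(** Sort the rows of [g] along each arc, then standardize. *)
Lemma lin_surj J S : L \in S -> forall g,
  exists2 p, p \in [set p | (idesc p \subset J) && (perm_cDes p \subset S)]
           & equivS (rowJ J) S p g.
Proof.
move=> LS g; have [r [Ar sr]] := sort_perm (arc S) (fun i => rowJ J (g i)) (@ord_inj n).
have [s si sE] := standardize (@rowJ_mono J) (r * g)%g.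
exists s; last first.
  by rewrite equivS_sym; apply/equivSP; exists r; split=> // i; rewrite sE permM.
rewrite inE; apply/andP; split; first exact/row_increasingP.
apply/cDes_subP => i iS; have e := ordS_val LS iS.
rewrite (row_increasing_lt (@rowJ_mono J)) // !sE !permM.
have : i < ordS i by rewrite e.
move=> /[dup] lt /(sr _ _ (esym (arc_ordS iS))).
by rewrite lt andbT leq_eqVlt orbC.
Qed.

Lemma card_rot_lin J S : L \in S ->
  #|[set p | (idesc (normp p) \subset J) && (perm_cDes p \subset S)]| =
  #|[set p | (idesc p \subset J) && (perm_cDes p \subset S)]|.
Proof.
move=> LS; have S0 : 0 < #|S| by rewrite card_gt0; apply/set0Pn; exists L.
apply: (card_transversal (R := equivS (rowJ J) S) (f := rot_rep) (g := id)).
- exact: equivS_sym.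
- exact: equivS_trans.
- exact: rot_rep_inj.
- exact: rot_rep_surj.
- exact: lin_inj.
- exact: lin_surj.
Qed.

Lemma shift1E S : shift1 S = [set ordS i | i in S].
Proof.
apply/setP => j; rewrite inE; apply/existsP/imsetP => [[i /andP[iS /eqP e]]|[i iS ->]].
  by exists i => //; apply/val_inj.
by exists i; rewrite iS /=.
Qed.

Lemma arc_shift1 S i j :
  (arc (shift1 S) (ordS i) == arc (shift1 S) (ordS j)) = (arc S i == arc S j).
Proof.
have cS : #|shift1 S| = #|S| by rewrite shift1E card_imset //; apply: ordS_inj.
(* Shifting moves a cut at [L] to 0, so all counts change by the same constant modulo [#|S|]. *)
suff E u : arc (shift1 S) (ordS u) = (cnt S u + (L \in S)) %% #|S|.
  by rewrite !E /arc eqn_modDr.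
rewrite /arc cS; case: (eqVneq u L) => [->|uL].
  by rewrite ordS_max cnt0 cnt_ordmax mod0n modnn.
have lt : u.+1 < n by move: uL; rewrite -val_eqE /=; have := ltn_ord u; lia.
congr (_ %% _); rewrite /cnt [ordS u : nat]/= modn_small //.
have -> : [set d in shift1 S | d < u.+1] = [set ordS d | d in [set d in S | (d < u) || (d == L)]].
  apply/setP => d; rewrite -[d]ord_predK mem_imset; last exact: ordS_inj.
  rewrite shift1E !inE mem_imset; last exact: ordS_inj.
  move: (ord_pred d) => e; congr (_ && _); rewrite -val_eqE /=.
  have := ltn_ord e; case: (ltngtP e.+1 n) => [le|le|le] le'; [|lia|].
    by rewrite modn_small //; move: uL; rewrite -val_eqE /=; lia.
  by rewrite le modnn; lia.
rewrite card_imset; last exact: ordS_inj.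
rewrite (cardsD1 L) !inE eqxx orbT andbT addnC; congr (_ + _).
apply: eq_card => d; rewrite !inE; case: (eqVneq d L) => [->|_] /=; last by rewrite orbF.
by case: (L \in S) => //=; lia.
Qed.

Definition ordSp : {perm 'I_n} := perm (@ordS_inj n).

Lemma equivS_shift1 (row : 'I_n -> nat) S g g' :
  equivS row S (ordSp * g)%g (ordSp * g')%g = equivS row (shift1 S) g g'.
Proof.
apply/equivSP/equivSP => -[r [Ar gr]].
  exists (ordSp^-1 * r * ordSp)%g; split=> i; rewrite -[i](permKV ordSp).
    by rewrite !permM permK !permE; apply/eqP; rewrite arc_shift1 Ar.
  by have := gr (ordSp^-1%g i); rewrite !permM permKV.
exists (ordSp * r * ordSp^-1)%g; split=> i; last by rewrite !permM permKV gr.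
have e k : ordS k = ordSp k by rewrite permE.
by apply/eqP; rewrite -arc_shift1 !e !permM permKV Ar.
Qed.

(** Rotating positions carries the classes for [shift1 S] to those for [S], so both sets are
    transversals of the latter. *)
Lemma card_rot_shift J S :
  #|[set p | (idesc (normp p) \subset J) && (perm_cDes p \subset S)]| =
  #|[set p | (idesc (normp p) \subset J) && (perm_cDes p \subset shift1 S)]|.
Proof.
have [->|S0] := eqVneq S set0; first by rewrite shift1E imset0.
have cS : #|shift1 S| = #|S| by rewrite shift1E card_imset //; apply: ordS_inj.
rewrite -card_gt0 in S0.
apply: (card_transversal (R := equivS (rowJ J) S) (f := rot_rep)
  (g := fun p => (ordSp * rot_rep p)%g)).
- exact: equivS_sym.
- exact: equivS_trans.
- exact: rot_rep_inj.
- exact: rot_rep_surj.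
- by move=> p q pX qX; rewrite equivS_shift1; apply: rot_rep_inj.
- move=> g; have S0' : 0 < #|shift1 S| by rewrite cS.
  have [p pX E] := rot_rep_surj J S0' (ordSp^-1 * g)%g; exists p => //.
  by rewrite -[g](mulKVg ordSp) equivS_shift1.
Qed.

(** Inclusion-exclusion first for [perm_cDes], then for [idesc]. *)
Lemma card_cDes_shift J E :
  #|[set p | (idesc (normp p) == J) && (perm_cDes p == E)]| =
  #|[set p | (idesc (normp p) == J) && (perm_cDes p == shift1 E)]|.
Proof.
(* Pulling back by [ordS] turns the bound [shift1 S] into [S], since [card_sub_moebius] takes the
   same bound on both sides. *)
have preE p S : (ordS (n := n) @^-1: perm_cDes p \subset S) = (perm_cDes p \subset shift1 S).
  rewrite shift1E; apply/subsetP/subsetP => H i; last first.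
    by rewrite inE => /H; rewrite mem_imset //; apply: ordS_inj.
  by rewrite -[i]ord_predK mem_imset; [move=> ?; apply: H; rewrite inE | apply: ordS_inj].
have preEq p S : (ordS (n := n) @^-1: perm_cDes p == S) = (perm_cDes p == shift1 S).
  rewrite !eqEsubset preE; congr (_ && _); rewrite shift1E.
  apply/subsetP/subsetP => H i; first by case/imsetP => k /H; rewrite inE => ? ->.
  by move=> iS; rewrite inE; apply: H; apply: imset_f.
have step1 I : #|[set p | (idesc (normp p) \subset I) && (perm_cDes p == E)]| =
    #|[set p | (idesc (normp p) \subset I) && (perm_cDes p == shift1 E)]|.
  have := @card_sub_moebius _ _ _ (fun p => idesc (normp p) \subset I)
    (fun p => idesc (normp p) \subset I) (@perm_cDes n)
    (fun p => ordS (n := n) @^-1: perm_cDes p) _ E.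
  move=> H; rewrite H => [|S].
    by apply: eq_card => p; rewrite !inE preEq.
  by apply: (etrans (card_rot_shift I S)); apply: eq_card => p; rewrite !inE preE.
have := @card_sub_moebius _ _ _ (fun p => perm_cDes p == E)
  (fun p => perm_cDes p == shift1 E) (fun p => idesc (normp p))
  (fun p => idesc (normp p)) _ J.
move=> H; transitivity #|[set p | (perm_cDes p == E) && (idesc (normp p) == J)]|.
  by apply: eq_card => p; rewrite !inE andbC.
rewrite H => [|I]; first by apply: eq_card => p; rewrite !inE andbC.
transitivity #|[set p | (idesc (normp p) \subset I) && (perm_cDes p == E)]|.
  by apply: eq_card => p; rewrite !inE andbC.
by rewrite step1; apply: eq_card => p; rewrite !inE andbC.
Qed.

Definition linDes p := [set i in perm_cDes p | i.+1 < n].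

Lemma card_linDes J E :
  #|[set p | (idesc (normp p) == J) && (linDes p == E)]| =
  #|[set p | (idesc p == J) && (linDes p == E)]|.
Proof.
(* A cut at [L] lifts the condition on the cyclic step from the last position to the first. *)
have subE p S : (linDes p \subset S) = (perm_cDes p \subset L |: S).
  apply/subsetP/subsetP => H i => [ip|].
    rewrite !inE; case: (eqVneq i L) => //= iL; apply: H; rewrite inE ip.
    by move: iL; rewrite -val_eqE /=; have := ltn_ord i; lia.
  rewrite inE => /andP[/H]; rewrite !inE => /orP[/eqP->|//].
  by rewrite ltnn.
have step1 I : #|[set p | (idesc (normp p) \subset I) && (linDes p == E)]| =
    #|[set p | (idesc p \subset I) && (linDes p == E)]|.
  apply: (card_sub_moebius (P := fun p => idesc (normp p) \subset I)
    (Q := fun p => idesc p \subset I)) => S.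
  have := @card_rot_lin I (L |: S); rewrite !inE eqxx => /(_ isT) H.
  transitivity #|[set p | (idesc (normp p) \subset I) && (perm_cDes p \subset L |: S)]|.
    by apply: eq_card => p; rewrite !inE subE.
  by rewrite H; apply: eq_card => p; rewrite !inE subE.
have H := @card_sub_moebius _ _ _ (fun p => linDes p == E)
  (fun p => linDes p == E) (fun p => idesc (normp p)) (@idesc).
transitivity #|[set p | (linDes p == E) && (idesc (normp p) == J)]|.
  by apply: eq_card => p; rewrite !inE andbC.
rewrite H => [|I]; first by apply: eq_card => p; rewrite !inE andbC.
transitivity #|[set p | (idesc (normp p) \subset I) && (linDes p == E)]|.
  by apply: eq_card => p; rewrite !inE andbC.
by rewrite step1; apply: eq_card => p; rewrite !inE andbC.
Qed.

End Equidistribution.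

(** * Tableaux of a ribbon with a detached box *)

(** In a decreasing sequence the zeros come last, and 0 is also the default of [nth]. *)
Lemma nth_filter_pos (s : seq nat) i :
  sorted geq s -> nth 0 [seq x <- s | 0 < x] i = nth 0 s i.
Proof.
have geqT : transitive geq by move=> a b c; rewrite /geq /=; lia.
elim: s i => [|x s IH] i //= xs; case: posnP => [x0|x0] /=; last first.
  by case: i => [|i] //=; apply: IH; apply: path_sorted xs.
have := order_path_min geqT xs; rewrite x0 => /allP s0.
rewrite (_ : filter _ _ = [::]); last first.
  by apply/eqP; rewrite -[_ == _]negbK -has_filter; apply/hasPn => y /s0; rewrite /geq /=; lia.
rewrite nth_nil; case: i => [|i] //=; case: (ltnP i (size s)) => [/(mem_nth 0)/s0|/(nth_default 0)->//].
by rewrite /geq /=; lia.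
Qed.

Lemma sumn_filter_pos (s : seq nat) : sumn [seq x <- s | 0 < x] = sumn s.
Proof. by elim: s => //= x s <-; case: posnP => [->|]. Qed.

Section Ribbon.
Variable m : nat.
Local Notation n := m.+2.
Local Notation L := (@ord_max m.+1).
Implicit Types (p s g r : {perm 'I_n}) (i j u v w y : 'I_n).
Variable J : {set 'I_n}.
Hypothesis J_lt : forall j, j \in J -> j.+2 < n.

Local Notation row := (rowJ J).
Local Notation K := (rowJ J L).

Lemma row0 : row ord0 = 0.
Proof. exact: cnt0. Qed.

Lemma rowK v : (row v == K) = (v == L).
Proof. by case: (eqVneq v L) => [->|/(rowJ_max J)]; rewrite ?eqxx //; case: ltngtP. Qed.

(** Rows being intervals of values, this is the first value of row [k], and [n] for [k = K.+1]. *)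
Definition rstart (k : nat) := #|[set v | row v < k]|.

Lemma rstart_gt v k : (v < rstart k) = (row v < k).
Proof.
rewrite /rstart; apply/idP/idP; last first.
  move=> lt; rewrite -[X in X <= _](card_ord_lt (ltn_ord v)).
  apply/subset_leq_card/subsetP => u; rewrite !inE ltnS leq_eqVlt.
  by case/predU1P => [/val_inj->//|/(rowJ_mono J)/leq_ltn_trans]; apply.
apply: contraTT; rewrite -!leqNgt => le; rewrite -[X in _ <= X](card_ord_lt (ltnW (ltn_ord v))).
apply/subset_leq_card/subsetP => u; rewrite !inE; apply: contraTT; rewrite -!leqNgt.
by rewrite leq_eqVlt => /predU1P[/val_inj<-//|/(rowJ_mono J)]; apply: leq_trans.
Qed.

Lemma rstart_max k : rstart k <= n.
Proof. by rewrite -[X in _ <= X]card_ord; apply: max_card. Qed.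

Lemma rstart0 : rstart 0 = 0.
Proof. by apply/eqP; rewrite cards_eq0; apply/eqP/setP => v; rewrite !inE. Qed.

Lemma rstart_all : rstart K.+1 = n.
Proof.
by have := rstart_gt L K.+1; have := rstart_max K.+1; rewrite ltnS leqnn /=; lia.
Qed.

(** From one value to the next the row rises by at most one, so no row is empty. *)
Lemma rstartS k : k <= K -> rstart k < rstart k.+1.
Proof.
move=> kK; have lt : rstart k < n by have := rstart_gt L k; rewrite (ltnNge K) kK /=; lia.
pose v := Ordinal lt; rewrite -[rstart k]/(v : nat) rstart_gt ltnS.
have ge : k <= row v by rewrite leqNgt -rstart_gt /= ltnn.
case: (posnP v) => [v0|vgt]; first by rewrite (_ : v = ord0) ?row0 //; apply/val_inj.
have {}vgt : 0 < rstart k := vgt.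
have lw : (rstart k).-1 < n by lia.
pose w := Ordinal lw; have wv : w.+1 < n by rewrite /=; lia.
have -> : v = ordS w by apply/val_inj; rewrite /= modn_small //=; lia.
rewrite rowJ_succ //; have : row w < k by rewrite -rstart_gt /=; lia.
by case: (_ || _); lia.
Qed.

Lemma rstart_ge k : k <= K.+1 -> k <= rstart k.
Proof. by elim: k => // k IH le; apply: leq_ltn_trans (IH (ltnW le)) (rstartS _). Qed.

(* English rows are numbered from the top while the reading order starts at the
   bottom: English row [t] is block [K - t], and [t = 0] is the detached box,
   pushed one column to the right of the ribbon. *)
Definition lamf (t : nat) := rstart (K - t).+1 - (K - t) + (t == 0).
Definition muf (t : nat) := rstart (K - t) - (K - t) + (t == 0).

Definition rlam := mkseq lamf K.+1.
Definition rmu := [seq x <- mkseq muf K.+1 | 0 < x].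

Lemma lamf_dec t : t < K -> lamf t.+1 <= lamf t.
Proof.
move=> tK; rewrite /lamf (_ : (K - t.+1).+1 = K - t) /=; last lia.
have := @rstartS (K - t); lia.
Qed.

Lemma muf_dec t : t < K -> muf t.+1 <= muf t.
Proof.
move=> tK; rewrite /muf; have := @rstartS (K - t.+1).
by rewrite (_ : (K - t.+1).+1 = K - t) /=; lia.
Qed.

Lemma sorted_mkseq_geq f k : (forall t, t.+1 < k -> f t.+1 <= f t) -> sorted geq (mkseq f k).
Proof.
move=> dec; apply/(sortedP 0) => t; rewrite size_mkseq => lt.
by rewrite !nth_mkseq //; [apply: dec | apply: ltnW].
Qed.

Lemma nth_rlam t : nth 0 rlam t = if t <= K then lamf t else 0.
Proof. by case: leqP => le; [rewrite nth_mkseq | rewrite nth_default // size_mkseq]. Qed.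

Lemma nth_rmu t : nth 0 rmu t = if t <= K then muf t else 0.
Proof.
rewrite nth_filter_pos; last by apply: sorted_mkseq_geq => k; rewrite ltnS; apply: muf_dec.
by case: leqP => le; [rewrite nth_mkseq | rewrite nth_default // size_mkseq].
Qed.

Lemma ribbon_skew_shape : skew_shape n rlam rmu.
Proof.
have geqT : transitive geq by move=> a b c; rewrite /geq /=; lia.
apply/and5P; split.
- rewrite /is_partition sorted_mkseq_geq => [|t]; last by rewrite ltnS; apply: lamf_dec.
  apply/(all_nthP 0) => t; rewrite size_mkseq => lt; rewrite nth_mkseq //.
  by rewrite /lamf; have := @rstart_ge (K - t).+1; lia.
- rewrite /is_partition filter_all andbT; apply: sorted_filter => //.
  by apply: sorted_mkseq_geq => t; rewrite ltnS; apply: muf_dec.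
- by rewrite size_filter size_mkseq -[X in _ <= X](size_mkseq muf) count_size.
- apply/allP => t _; rewrite nth_rmu nth_rlam; case: (leqP t K) => // le.
  by rewrite /muf /lamf; have := @rstartS (K - t); lia.
- rewrite sumn_filter_pos.
  (* The top [k] rows hold the values from [rstart (K.+1 - k)] on. *)
  have H k : k <= K.+1 ->
      sumn (mkseq lamf k) + rstart (K.+1 - k) = sumn (mkseq muf k) + n.
    elim: k => [|k IH] le; first by rewrite subn0 rstart_all.
    have := IH (ltnW le); rewrite !mkseqS !sumn_rcons {IH} /lamf /muf subSS subSn //.
    have : K - k <= K by rewrite leq_subr.
    move: (K - k) => t tK; have := rstartS tK; have := rstart_ge (leqW tK); lia.
  by have := H K.+1 (leqnn _); rewrite subnn rstart0 addn0 => ->.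
Qed.

(** In reading order the ribbon goes right inside a row and straight up at a cut, hence column
    [v - row v]; the box is pushed one further. *)
Definition ccol v := v - row v + (v == L).

Lemma row_le v : row v <= v.
Proof.
rewrite -[X in _ <= X](card_ord_lt (ltnW (ltn_ord v))).
by apply/subset_leq_card/subsetP => u; rewrite !inE => /andP[].
Qed.

Lemma in_skew_cell v : in_skew rlam rmu (K - row v) (ccol v).
Proof.
have le : row v <= K by apply: row_le_max (@rowJ_max _ J) _.
rewrite /in_skew nth_rlam nth_rmu leq_subr /lamf /muf subKn // /ccol -(rowK v).
have -> : (K - row v == 0) = (row v == K) by lia.
have := rstart_gt v (row v); have := rstart_gt v (row v).+1; rewrite ltnS leqnn ltnn.
have := row_le v; have := @rstart_ge (row v); have := row_le v; lia.
Qed.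

Lemma skew_cellP t c : in_skew rlam rmu t c -> exists v, t = K - row v /\ c = ccol v.
Proof.
rewrite /in_skew nth_rlam nth_rmu; case: (leqP t K) => // tK.
rewrite /lamf /muf => /andP[le lt].
have b1 : rstart (K - t) <= c - (t == 0) + (K - t) < rstart (K - t).+1.
  by have := @rstart_ge (K - t); lia.
have lt' : c - (t == 0) + (K - t) < n by have := rstart_max (K - t).+1; lia.
pose v := Ordinal lt'; have rv : row v = K - t.
  have := rstart_gt v (K - t); have := rstart_gt v (K - t).+1; rewrite ltnS /=; lia.
exists v; rewrite /ccol -(rowK v) rv; split; first lia.
rewrite /=; have -> : (K - t == K) = (t == 0).
  have : 0 < K by apply: leq_ltn_trans (rowJ_max J (u := ord0) _).
  lia.
by move: le; case: (t == 0); lia.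
Qed.

Lemma cell_row_lt v : K - row v < size rlam.
Proof. by rewrite size_mkseq ltnS leq_subr. Qed.

Lemma cell_col_lt v : ccol v < head 0 rlam.
Proof.
have /andP[_ lt] := in_skew_cell v; apply: leq_trans lt _.
rewrite nth_rlam leq_subr -nth0 nth_rlam /=.
have := leq_subr (row v) K; elim: (K - row v) => // t IH lt.
exact: leq_trans (lamf_dec lt) (IH (ltnW lt)).
Qed.

Definition cell v : cellT rlam := (Ordinal (cell_row_lt v), Ordinal (cell_col_lt v)).

Lemma cell_row v : (cell v).1 = K - row v :> nat.
Proof. by []. Qed.

Lemma cell_col v : (cell v).2 = ccol v :> nat.
Proof. by []. Qed.

Lemma cell_inj : injective cell.
Proof.
move=> u v [] er ec.
have lu : row u <= K by apply: row_le_max (@rowJ_max _ J) _.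
have lv : row v <= K by apply: row_le_max (@rowJ_max _ J) _.
have e : row u = row v by lia.
apply/val_inj; move: ec; rewrite /ccol -(rowK u) -(rowK v) e.
by have := row_le u; have := row_le v; rewrite /=; lia.
Qed.

Lemma cell_inP (x : cellT rlam) : cell_in rmu x -> exists v, x = cell v.
Proof.
case: x => t c /skew_cellP[v [et ec]]; exists v.
by congr (_, _); apply/val_inj.
Qed.

Lemma cell_col_box v : v != L -> ccol v < ccol L.
Proof.
move=> vL; have := in_skew_cell v; have := in_skew_cell L.
have gt : 0 < K - row v by have := rowJ_max J vL; lia.
rewrite /in_skew !nth_rlam !nth_rmu subnn leq_subr /= /muf => /andP[leL _] /andP[_ lt].
apply: leq_trans lt (leq_trans _ leL); rewrite subn0 addn1.
have : lamf (K - row v) <= lamf 1.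
  have : 1 <= K - row v <= K by rewrite gt leq_subr.
  elim: (K - row v) => // t IH; case: (posnP t) => [-> //|tgt] /andP[_ lt].
  by apply: leq_trans (lamf_dec lt) (IH _); rewrite tgt ltnW.
rewrite /lamf /= addn0; have -> : (K - 1).+1 = K by lia.
have := @rstart_ge K; lia.
Qed.

Lemma ribbon_not_connected : ~~ connected_ribbon rlam rmu.
Proof.
rewrite /connected_ribbon negb_and; apply/orP; left; apply/negP => /forallP/(_ (cell L)).
move=> /forallP/(_ (cell ord0)) /implyP/(_ (in_skew_cell L)) /implyP/(_ (in_skew_cell ord0)).
case/connectP => [[|y q]] /=; first by move=> _ /cell_inj.
(* A path leaving the box needs a cell in its row or column, and there is no other. *)
case/andP => /and3P[_ yin adj] _ _; have [v ev] := cell_inP yin; rewrite {}ev /= in adj.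
case: (eqVneq v L) adj => [->|vL]; first by rewrite !eqxx /=; lia.
by have := cell_col_box vL; have := rowJ_max J vL; rewrite /=; lia.
Qed.

(** [p i] is the place in reading order of the cell holding entry [i]. *)
Definition tab_of p : tab n rlam := [ffun i => cell (p i)].

Lemma tab_of_inj : injective tab_of.
Proof.
move=> p q /ffunP e; apply/permP => i; apply: cell_inj.
by have := e i; rewrite !ffunE.
Qed.

Lemma cnt_setC (D : {set 'I_n}) v : cnt D v + cnt (~: D) v = v.
Proof.
rewrite -[RHS](card_ord_lt (ltnW (ltn_ord v))) -cardsUI.
rewrite [X in _ + X](_ : _ = 0) ?addn0; last first.
  by apply/eqP; rewrite cards_eq0; apply/eqP/setP => u; rewrite !inE; case: (u \in D); rewrite ?andbF.
by apply: eq_card => u; rewrite !inE; case: (u \in D); rewrite ?orbF.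
Qed.

Lemma rowJ_cnt v : v != L -> row v = cnt J v.
Proof.
rewrite -val_eqE /= => vL; apply: eq_card => u; rewrite !inE; case: (u \in J) => //=.
by have := ltn_ord v; lia.
Qed.

Lemma tab_of_SYT p : idesc p = J -> tab_of p \in SYT n rlam rmu.
Proof.
move=> pJ; have pi : row_increasing row p by apply/row_increasingP; rewrite pJ.
have rK v : row v <= K by apply: row_le_max (@rowJ_max _ J) _.
rewrite inE; apply/and4P; split.
- by apply/injectiveP => i j; rewrite !ffunE => /cell_inj/perm_inj.
- by apply/forallP => i; rewrite ffunE; apply: in_skew_cell.
- apply/forallP => a; apply/forallP => b; rewrite !ffunE /=; apply/implyP => /andP[/eqP er].
  have {}er : row (p a) = row (p b) by have := rK (p a); have := rK (p b); lia.
  rewrite /ccol -(rowK (p a)) -(rowK (p b)) er => lt.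
  case: (ltngtP a b) => // [/(pi _ _ (esym er))|/val_inj ab]; last by rewrite ab ltnn in lt.
  by have := row_le (p a); have := row_le (p b); rewrite er; lia.
- apply/forallP => a; apply/forallP => b; rewrite !ffunE /=; apply/implyP => /andP[/eqP ec lt].
  have {}lt : row (p b) < row (p a) by have := rK (p a); have := rK (p b); lia.
  have aL : p a != L.
    apply/eqP => paL; move: ec lt; rewrite paL; case: (eqVneq (p b) L) => [->|/cell_col_box]; lia.
  have bL : p b != L.
    by apply: contraTneq lt => ->; rewrite -leqNgt.
  have lt' : p b < p a := row_lt (@rowJ_mono _ J) lt.
  (* Columns count the values outside [J]; equal columns mean that all steps between the two values
     are inverse descents. *)
  have ec' : cnt (~: J) (p b) = cnt (~: J) (p a).
    move: ec; rewrite /ccol (negbTE aL) (negbTE bL) !addn0 !rowJ_cnt //.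
    by have := cnt_setC J (p a); have := cnt_setC J (p b); lia.
  (* down a column the inverse permutation decreases, hence the reversal *)
  have H := @cnt_chain _ (fun v => n - p^-1%g v) (~: J) _ _ _ lt' ec'.
  suff : n - b < n - a by lia.
  rewrite !permK in H; apply: H => w w' e; rewrite inE negbK -pJ inE (ordS_lt e) => /andP[_].
  by have := ltn_ord (p^-1%g w); lia.
Qed.

Lemma tab_of_onto T : T \in SYT n rlam rmu -> exists2 p, idesc p = J & T = tab_of p.
Proof.
rewrite inE => /and4P[/injectiveP injT /forallP inT /forallP rowT /forallP colT].
have fP i : exists v, T i == cell v by have [v ->] := cell_inP (inT i); exists v.
pose f i := xchoose (fP i).
have fE i : T i = cell (f i) by apply/eqP; exact: (xchooseP (fP i)).
have injf : injective f by move=> i j e; apply: injT; rewrite !fE e.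
pose p := perm injf.
have TE : T = tab_of p by apply/ffunP => i; rewrite fE ffunE permE.
have cE v : T (p^-1%g v) = cell v by rewrite TE ffunE permKV.
exists p => //; apply/setP => i; rewrite inE; case: (ltnP i.+2 n) => [lt|ge]; last first.
  by apply/esym/negP => /J_lt; lia.
have iS : ordS i = i.+1 :> nat by rewrite /= modn_small // ltnW.
have iL : (i == L) = false by apply/negbTE; rewrite -val_eqE /=; lia.
have SL : (ordS i == L) = false by apply/negbTE/eqP => /(congr1 (@nat_of_ord n)); rewrite iS /=; lia.
have rS := @rowJ_succ _ J i (ltnW lt); rewrite (_ : (i.+2 == n) = false) ?orbF in rS; last lia.
have rK : row (ordS i) <= K by apply: row_le_max (@rowJ_max _ J) _.
have ri := row_le i; rewrite /=.
(* The cells of [i] and [ordS i] share a column if [i] is in [J] and a row otherwise, so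
   standardness of [T] decides the comparison. *)
case: (boolP (i \in J)) rS => iJ rS.
  have /forallP/(_ (p^-1%g i)) := colT (p^-1%g (ordS i)).
  rewrite !cE !cell_row !cell_col /ccol SL iL iS rS => /implyP; apply; lia.
have /forallP/(_ (p^-1%g (ordS i))) := rowT (p^-1%g i).
rewrite !cE !cell_row !cell_col /ccol SL iL iS rS => /implyP H.
by apply/negbTE; rewrite -leqNgt ltnW //; apply: H; lia.
Qed.

(** Successive entries in one row of the shape are in increasing order of reading, so [p] drops
    exactly on moving to a lower row. *)
Lemma tab_of_Des p : idesc p = J -> tab_Des (tab_of p) = linDes p.
Proof.
move=> pJ; have pi : row_increasing row p by apply/row_increasingP; rewrite pJ.
have rK v : row v <= K by apply: row_le_max (@rowJ_max _ J) _.
have E i j : j = i.+1 :> nat -> (K - row (p i) < K - row (p j)) = (p j < p i).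
  move=> e; rewrite (row_increasing_lt (@rowJ_mono _ J)) //.
  by have := rK (p i); have := rK (p j); lia.
apply/setP => i; rewrite !inE; apply/existsP/idP => [[j /andP[/eqP e]]|].
  rewrite !ffunE /= E // => lt; rewrite -e ltn_ord andbT.
  by apply/existsP; exists j; rewrite lt e modn_small ?eqxx //= -e.
case/andP => /existsP[j /andP[/eqP e lt]] ltn; rewrite modn_small // in e.
by exists j; rewrite e eqxx !ffunE /= E.
Qed.

Lemma card_SYT_Des E :
  #|[set T in SYT n rlam rmu | tab_Des T == E]| =
  #|[set p | (idesc p == J) && (linDes p == E)]|.
Proof.
rewrite -(card_imset [set p | (idesc p == J) && (linDes p == E)] tab_of_inj).
apply: eq_card => T; rewrite inE; apply/andP/imsetP => [[/tab_of_onto[p pJ ->] TE]|[p]].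
  by exists p => //; rewrite inE pJ eqxx -tab_of_Des.
by rewrite inE => /andP[/eqP pJ /eqP <-] ->; rewrite tab_of_SYT ?tab_of_Des.
Qed.

End Ribbon.

(** * The cyclic descent extension *)

Section FiberMatching.
Variables (X Y : finType) (Z : eqType) (A : {set X}) (B : {set Y}).
Variables (f : X -> Z) (g : Y -> Z) (d : X -> Y).

(** The k-th element of a fibre of [f] goes to the k-th element of the fibre of [g] over the same
    value; [d x] is only the default of [nth]. *)
Definition fiber_match x :=
  nth (d x) (enum [set y in B | g y == f x]) (index x (enum [set x' in A | f x' == f x])).

Hypothesis fibers :
  forall z, #|[set x in A | f x == z]| = #|[set y in B | g y == z]|.

Lemma fiber_index_lt x : x \in A ->
  index x (enum [set x' in A | f x' == f x]) < size (enum [set y in B | g y == f x]).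
Proof. by move=> xA; rewrite -cardE -fibers cardE index_mem mem_enum inE xA eqxx. Qed.

Lemma fiber_matchP x : x \in A -> fiber_match x \in B /\ g (fiber_match x) = f x.
Proof.
by move=> /fiber_index_lt/(mem_nth (d x)); rewrite mem_enum inE => /andP[? /eqP].
Qed.

Lemma fiber_match_inj : {in A &, injective fiber_match}.
Proof.
move=> x x' xA xA' e; have ef : f x = f x'.
  by rewrite -(fiber_matchP xA).2 -(fiber_matchP xA').2 e.
have lt := fiber_index_lt xA; have lt' := fiber_index_lt xA'.
move: e; rewrite /fiber_match -ef in lt' *; rewrite (set_nth_default (d x) (d x')) // => /eqP.
rewrite nth_uniq ?enum_uniq // => /eqP ei.
have mx : x \in enum [set x' in A | f x' == f x] by rewrite mem_enum inE xA eqxx.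
have mx' : x' \in enum [set x' in A | f x' == f x] by rewrite mem_enum inE xA' ef eqxx.
by rewrite -(nth_index x mx) ei nth_index.
Qed.

End FiberMatching.

Lemma fiber_match_onto (X Y : finType) (Z : eqType) (A : {set X}) (B : {set Y})
    (f : X -> Z) (g : Y -> Z) (d : X -> Y) (d' : Y -> X) :
  (forall z, #|[set x in A | f x == z]| = #|[set y in B | g y == z]|) ->
  fiber_match A B f g d @: A = B.
Proof.
move=> fib; apply/eqP; rewrite eqEcard; apply/andP; split.
  by apply/subsetP => _ /imsetP[x xA ->]; have [] := fiber_matchP d fib xA.
rewrite card_in_imset; last exact: fiber_match_inj.
have fib' z := esym (fib z).
rewrite -(card_in_imset (fiber_match_inj (d := d') fib')); apply/subset_leq_card/subsetP.
by move=> _ /imsetP[y yB ->]; have [] := fiber_matchP d' fib' yB.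
Qed.

(** The position of the smallest value is not a cyclic descent; the one before it is. *)
Lemma perm_cDes_proper m (p : {perm 'I_m.+2}) :
  perm_cDes p != set0 /\ perm_cDes p != setT.
Proof.
pose y := p^-1%g ord0; have py : p y = ord0 by rewrite permKV.
split; apply/eqP => /setP E.
  have := E (ord_pred y); rewrite in_cDes inE ord_predK py.
  by have := perm_ordS_neq p (ord_pred y); rewrite ord_predK py /= => H; case: (posnP (p _)) H => // ->.
by have := E y; rewrite in_cDes inE py.
Qed.

Section CyclicSchurPositive.
Variable m : nat.
Local Notation n := m.+2.
Variable J : {set 'I_n}.
Hypothesis J_lt : forall j : 'I_n, j \in J -> j.+2 < n.

(** Defined for all shapes because [cyclic_Schur_positive] asks for a family; on the ribbon it is a
    bijection preserving descents. *)
Definition rot_match (lam mu : seq nat) : tab n lam -> {perm 'I_n} :=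
  fiber_match (SYT n lam mu) (rotClass (invDesClass J)) (@tab_Des n lam) (@linDes m) (fun=> 1%g).

Definition SYT_cDes (lam mu : seq nat) (T : tab n lam) := perm_cDes (rot_match mu T).

Local Notation lam := (rlam J).
Local Notation mu := (rmu J).

Lemma card_SYT_rot E :
  #|[set T in SYT n lam mu | tab_Des T == E]| =
  #|[set p in rotClass (invDesClass J) | linDes p == E]|.
Proof.
rewrite card_SYT_Des // -card_linDes; apply: eq_card => p.
by rewrite !inE [in RHS]/= -in_rotClass inE.
Qed.

Lemma rot_match_onto : @rot_match lam mu @: SYT n lam mu = rotClass (invDesClass J).
Proof. exact: (fiber_match_onto _ (fun=> tab_of J 1%g) card_SYT_rot). Qed.

Lemma rot_match_inj : {in SYT n lam mu &, injective (@rot_match lam mu)}.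
Proof. exact: fiber_match_inj card_SYT_rot. Qed.

Lemma card_SYT_cDes E :
  #|[set T in SYT n lam mu | SYT_cDes mu T == E]| =
  #|[set p | (idesc (normp p) == J) && (perm_cDes p == E)]|.
Proof.
have -> : [set p | (idesc (normp p) == J) && (perm_cDes p == E)] =
    @rot_match lam mu @: [set T in SYT n lam mu | SYT_cDes mu T == E].
  apply/setP => p; rewrite inE -in_rotClass -rot_match_onto.
  apply/andP/imsetP => [[/imsetP[T TS ->] TE]|[T]]; first by exists T; rewrite // inE TS.
  by rewrite inE => /andP[TS TE] ->; split; first exact: imset_f.
rewrite card_in_imset // => T T' /setIdP[TS _] /setIdP[TS' _].
by apply: rot_match_inj.
Qed.

Lemma shift1_inj : injective (@shift1 n).
Proof. by move=> S S'; rewrite !shift1E => /imset_inj; apply; apply: ordS_inj. Qed.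

Lemma shift1_onto E : exists E', E = @shift1 n E'.
Proof.
exists [set i | ordS i \in E]; rewrite shift1E; apply/setP => i.
by rewrite -[i]ord_predK mem_imset ?inE //; apply: ordS_inj.
Qed.

(** By rotation invariance, [shift1] of the cyclic descent set has the same distribution as the set
    itself; [psi] matches the fibres. *)
Lemma ribbon_cyclic_descent_ext : cyclic_descent_ext n lam mu (@SYT_cDes lam mu).
Proof.
have fib E : #|[set T in SYT n lam mu | shift1 (SYT_cDes mu T) == E]| =
    #|[set T in SYT n lam mu | SYT_cDes mu T == E]|.
  have [E' ->] := shift1_onto E; rewrite card_SYT_cDes -card_cDes_shift -card_SYT_cDes.
  by apply: eq_card => T; rewrite !inE (inj_eq shift1_inj).
exists (fiber_match (SYT n lam mu) (SYT n lam mu)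
  (fun T => shift1 (SYT_cDes mu T)) (@SYT_cDes lam mu) id); split; [|split].
- by move=> T TS; have [] := fiber_matchP id fib TS.
- exact: fiber_match_inj.
- move=> T TS; have [_ ->] := fiber_matchP id fib TS; split; last first.
    by split=> //; apply: perm_cDes_proper.
  by have [_ <-] := fiber_matchP (fun=> 1%g) card_SYT_rot TS.
Qed.

Lemma rotClass_cyclic_Schur_positive : cyclic_Schur_positive (rotClass (invDesClass J)).
Proof.
exists [:: (lam, mu, 1)], SYT_cDes; split.
  move=> x; rewrite inE => /eqP->; split => /=.
  - exact: ribbon_skew_shape.
  - exact: ribbon_not_connected.
  - exact: ribbon_cyclic_descent_ext.
rewrite big_seq1 GRing.scale1r -[in LHS]rot_match_onto big_imset //.
exact: rot_match_inj.
Qed.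

End CyclicSchurPositive.

Theorem theorem4p9 (n : nat) (J : {set 'I_n}) :
  (2 <= n)%N ->
  (forall j : 'I_n, j \in J -> ((nat_of_ord j).+2 < n)%N) ->
  cyclic_Schur_positive (rotClass (invDesClass J)).
Proof.
by case: n J => [|[|m]] // J _ J_lt; apply: rotClass_cyclic_Schur_positive.
Qed.
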